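(* The square root $$\sqrt{4xy^2(1+x)^2+\left(x(1+y)^2+y(1+x)^2\right)\cdot\left(x(1-y)^2+y(1-x)^2\right)}$$ cannot be rationalised by a rational variable change.
   Context: A rational variable change rationalising a square root $\sqrt{f(x,y)}$ with $f\in\mathbb{Q}[x,y]$ is a substitution $x=\varphi(s,t)$, $y=\psi(s,t)$ by rational functions $\varphi,\psi\in\mathbb{C}(s,t)$, defining a dominant rational map $(s,t)\mapsto(\varphi(s,t),\psi(s,t))$ to the plane, such that $\sqrt{f(\varphi(s,t),\psi(s,t))}$ becomes a rational function of $s,t$, i.e. $f(\varphi,\psi)$ is a square in $\mathbb{C}(s,t)$. *)

(* Defs.v *)
From mathcomp Require Import all_boot all_order all_algebra.
From mathcomp Require Import complex.
From mathcomp Require Import reals.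
From mathcomp Require Import mpoly.

Set Implicit Arguments.
Unset Strict Implicit.
Unset Printing Implicit Defensive.

Import GRing.Theory.
Local Open Scope ring_scope.
Local Open Scope complex_scope.

Definition pair_fun (T : Type) (a b : T) : 'I_2 -> T :=
  fun i => if i == 0 then a else b.

(* The function field K(s, t), with s = 'X_0 and t = 'X_1. *)
Definition ratfun2 (K : fieldType) := {fraction {mpoly K[2]}}.

Section RationalMaps.
Variable K : fieldType.
Implicit Types (phi psi : ratfun2 K) (A : K * K -> Prop).

(* phi is regular at p (some representation num / den has den(p) <> 0) and
   takes the value c there; c does not depend on the representation. *)
Definition ratfun2_value phi (p : K * K) (c : K) : Prop :=
  exists num den : {mpoly K[2]},
    [/\ den.@[pair_fun p.1 p.2] != 0,
        phi = tofrac num / tofrac den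
      & c = num.@[pair_fun p.1 p.2] / den.@[pair_fun p.1 p.2]].

(* Image of the rational map (s, t) |-> (phi, psi) on its domain of
   definition. *)
Definition ratmap_image phi psi (q : K * K) : Prop :=
  exists p : K * K, ratfun2_value phi p q.1 /\ ratfun2_value psi p q.2.

Definition zariski_closure A (q : K * K) : Prop :=
  forall P : {mpoly K[2]},
    (forall p, A p -> P.@[pair_fun p.1 p.2] = 0) ->
    P.@[pair_fun q.1 q.2] = 0.

Definition dominant phi psi : Prop :=
  forall q : K * K, zariski_closure (ratmap_image phi psi) q.

Definition mpoly_subst (f : {mpoly K[2]}) phi psi : ratfun2 K :=
  mmap (fun c : K => tofrac c%:MP_[2]) (pair_fun phi psi) f.

End RationalMaps.

Definition sqrt_rationalisable (R : realType) (f : {mpoly rat[2]}) : Prop :=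
  exists phi psi : ratfun2 R[i],
    dominant phi psi /\
    exists r : ratfun2 R[i],
      mpoly_subst (map_mpoly (ratr : rat -> R[i]) f) phi psi = r ^+ 2.

Definition radicand : {mpoly rat[2]} :=
  let x := 'X_0 in
  let y := 'X_1 in
  4%:R * x * y ^+ 2 * (1 + x) ^+ 2
  + (x * (1 + y) ^+ 2 + y * (1 + x) ^+ 2)
    * (x * (1 - y) ^+ 2 + y * (1 - x) ^+ 2).

(* Main.v *)
(* With X = x + 1/x and Y = y + 1/y the radicand is
   f = x^2 y^2 ((X + Y)^2 + 4 X - 8), a curve of bidegree (4, 4) on P^1 x P^1
   invariant under x -> 1/x and y -> 1/y; its only singular points are (1, -1)
   (type A3), (-1, -1) (type A1), and (0, 0) with its images under the
   inversions (type A2).  The double cover r^2 = f is thus a K3 surface with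
   rational double points, on which dx dy / r is a regular 2-form.  For x, y, r
   in C(s, t) with r^2 = f(x, y), the pulled back form h ds dt, where
   h = (x_s y_t - x_t y_s) / r, is regular at every place of C(t)(s) trivial on
   C(t), by explicit blow-ups of the singular points.  Hence h is a polynomial
   in s, and regularity at s = oo forces h = 0 because ds has a double pole
   there.  So the Jacobian of (x, y) vanishes, x and y are algebraically
   dependent over C, and the map is not dominant. *)

Require Import Defs.
From mathcomp Require Import all_boot all_order all_algebra.
From mathcomp Require Import reals.
From HB Require Import structures.
From mathcomp Require Import boolp complex mpoly.
From mathcomp Require Import ring zify.

Set Implicit Arguments.
Unset Strict Implicit.
Unset Printing Implicit Defensive.
Import GRing.Theory.
Local Open Scope ring_scope.

(** * Derivations and valuation rings *)

Definition is_derivation (R : pzRingType) (d : R -> R) : Prop :=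
  {morph d : x y / x + y} /\ forall x y, d (x * y) = d x * y + x * d y.

Section DerivationRules.
Variables (R : comPzRingType) (d : R -> R).
Hypothesis dP : is_derivation d.

Lemma derD x y : d (x + y) = d x + d y. Proof. by case: dP. Qed.

Lemma derM x y : d (x * y) = d x * y + x * d y. Proof. by case: dP. Qed.

Lemma der0 : d 0 = 0.
Proof. by apply: (addrI (d 0)); rewrite -derD !addr0. Qed.

Lemma derN x : d (- x) = - d x.
Proof. by apply: (addrI (d x)); rewrite -derD !subrr der0. Qed.

Lemma derB x y : d (x - y) = d x - d y.
Proof. by rewrite derD derN. Qed.

Lemma der1 : d 1 = 0.
Proof.
have := derM 1 1; rewrite !mulr1 mul1r => H.
by apply: (addrI (d 1)); rewrite addr0.
Qed.

Lemma der_natr n : d n%:R = 0.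
Proof. by elim: n => [|n IH]; rewrite ?der0 // -natr1 derD IH der1 addr0. Qed.

Lemma der_sqr x : d (x ^+ 2) = 2 * x * d x.
Proof. by rewrite expr2 derM; ring. Qed.

Lemma der_sum (I : Type) (s : seq I) (P : pred I) (E : I -> R) :
  d (\sum_(i <- s | P i) E i) = \sum_(i <- s | P i) d (E i).
Proof. exact: (big_morph d derD der0). Qed.

End DerivationRules.

Lemma der_inv (F : fieldType) (d : F -> F) (dP : is_derivation d) x :
  d x^-1 = - d x / x ^+ 2.
Proof.
have [->|x0] := eqVneq x 0; first by rewrite invr0 (der0 dP) oppr0 mul0r.
have H : d x * x^-1 + x * d x^-1 = 0.
  by rewrite -(derM dP) divff // (der1 dP).
have -> : d x^-1 = (d x * x^-1 + x * d x^-1) / x - d x / x ^+ 2 by field.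
by rewrite H mul0r add0r mulNr.
Qed.

Definition jacobian (R : pzRingType) (d1 d2 : R -> R) (x y : R) : R :=
  d1 x * d2 y - d2 x * d1 y.

Record valuation_ring (F : fieldType) (O : F -> Prop) : Prop := ValuationRing {
  vring1 : O 1;
  vringB : forall x y, O x -> O y -> O (x - y);
  vringM : forall x y, O x -> O y -> O (x * y);
  vring_total : forall x, O x \/ O x^-1
}.

Section ValuationRingTheory.
Variables (F : fieldType) (O : F -> Prop).
Hypothesis OP : valuation_ring O.

Let O1 : O 1 := vring1 OP.
Let OB x y := @vringB _ _ OP x y.
Let OM x y := @vringM _ _ OP x y.

Lemma vring0 : O 0. Proof. by rewrite -(subrr 1); apply: OB. Qed.
Lemma vringN x : O x -> O (- x).
Proof. by rewrite -sub0r; apply: OB => //; apply: vring0. Qed.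
Lemma vringD x y : O x -> O y -> O (x + y).
Proof. by move=> Ox Oy; rewrite -(opprK y); apply: OB => //; apply: vringN. Qed.
Lemma vringX x n : O x -> O (x ^+ n).
Proof. by move=> Ox; elim: n => [|n IH]; rewrite ?exprS ?expr0 //; apply: OM. Qed.
Lemma vring_nat n : O n%:R.
Proof. by elim: n => [|n IH]; [apply: vring0 | rewrite -natr1; apply: vringD]. Qed.

(** An instance of integral closedness: if [x^-1] lies in [O], then so does [x = x^2 * x^-1]. *)
Lemma vring_sqr x : O (x ^+ 2) -> O x.
Proof.
move=> Ox2; case: (vring_total OP x) => // OVx.
have [->|x0] := eqVneq x 0; first exact: vring0.
by (have -> : x = x ^+ 2 * x^-1 by field); apply: OM.
Qed.

(* The case [x = 0] is separate because [0^-1 = 0]. *)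
Definition vmax x := x = 0 \/ ~ O x^-1.

Lemma vmaxO x : vmax x -> O x.
Proof. by case=> [->|nOVx]; [apply: vring0 | case: (vring_total OP x)]. Qed.

Lemma vmaxMr x y : O x -> vmax y -> vmax (x * y).
Proof.
move=> Ox [->|nOVy]; first by rewrite mulr0; left.
have [->|x0] := eqVneq x 0; first by rewrite mul0r; left.
have [->|y0] := eqVneq y 0; first by rewrite mulr0; left.
right=> Oxy; apply: nOVy.
have -> : y^-1 = x * (x * y)^-1 by field; rewrite ?x0 ?y0.
by apply: OM.
Qed.

Lemma vmaxMl x y : O y -> vmax x -> vmax (x * y).
Proof. by rewrite mulrC; apply: vmaxMr. Qed.

Lemma vmaxN x : vmax x -> vmax (- x).
Proof. by rewrite -mulN1r; apply: vmaxMr; apply: vringN. Qed.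

(** One of [x / y] and [y / x] lies in [O], so the sum is an [O]-multiple of one of its two
    terms. *)
Lemma vmaxD x y : vmax x -> vmax y -> vmax (x + y).
Proof.
move=> mx my.
have [->|x0] := eqVneq x 0; first by rewrite add0r.
have [->|y0] := eqVneq y 0; first by rewrite addr0.
have [H|H] := vring_total OP (x / y).
  have -> : x + y = (x / y + 1) * y by field.
  by apply: vmaxMr => //; apply: vringD.
have -> : x + y = (1 + (x / y)^-1) * x by field; rewrite ?x0 ?y0.
by apply: vmaxMr => //; apply: vringD.
Qed.

Lemma vmaxB x y : vmax x -> vmax y -> vmax (x - y).
Proof. by move=> mx my; apply: vmaxD => //; apply: vmaxN. Qed.

Lemma vmaxX x n : vmax x -> vmax (x ^+ n.+1).
Proof. by move=> mx; rewrite exprS; apply: vmaxMl => //; apply/vringX/vmaxO. Qed.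

Lemma vmaxVP x : O x -> vmax x \/ (x != 0 /\ O x^-1).
Proof.
move=> Ox; have [->|x0] := eqVneq x 0; first by left; left.
have [H|H] := vring_total OP x^-1; first by right.
by case: (boolp.EM (O x^-1)) => [|nO]; [right | left; right].
Qed.

Lemma vmaxNV x : x != 0 -> O x^-1 -> ~ vmax x.
Proof. by move=> x0 OVx [x_0|//]; rewrite x_0 eqxx in x0. Qed.

Lemma vmax_prime x y : O x -> O y -> vmax (x * y) -> vmax x \/ vmax y.
Proof.
move=> Ox Oy mxy.
case: (vmaxVP Ox) => [|[x0 OVx]]; first by left.
case: (vmaxVP Oy) => [|[y0 OVy]]; first by right.
case: (vmaxNV (x := x * y)) => //; first by rewrite mulf_neq0.
by rewrite invfM; apply: OM.
Qed.

Lemma vmax_sqr x : O x -> vmax (x ^+ 2) -> vmax x.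
Proof. by move=> Ox; rewrite expr2 => /(vmax_prime Ox Ox); case. Qed.

(** Equality in the residue field, expressed inside [F] as congruence modulo the maximal ideal. *)
Definition veq x y := vmax (x - y).

Lemma veq_refl x : veq x x. Proof. by rewrite /veq subrr; left. Qed.

Lemma veqD x x' y y' : veq x x' -> veq y y' -> veq (x + y) (x' + y').
Proof.
move=> xx' yy'; rewrite /veq.
have -> : x + y - (x' + y') = (x - x') + (y - y') by ring.
exact: vmaxD.
Qed.

Lemma veqN x x' : veq x x' -> veq (- x) (- x').
Proof. by rewrite /veq -opprD; apply: vmaxN. Qed.

Lemma veqM x x' y y' : O x -> O y' -> veq x x' -> veq y y' -> veq (x * y) (x' * y').
Proof.
move=> Ox Oy' xx' yy'; rewrite /veq.
have -> : x * y - x' * y' = x * (y - y') + (x - x') * y' by ring.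
by apply: vmaxD; [apply: vmaxMr | apply: vmaxMl].
Qed.

Lemma veqX n x x' : O x -> O x' -> veq x x' -> veq (x ^+ n) (x' ^+ n).
Proof.
move=> Ox Ox' xx'; elim: n => [|n IH]; first exact: veq_refl.
by rewrite !exprS; apply: veqM => //; apply: (vringX _ Ox').
Qed.

Lemma vmax_veq x y : veq x y -> vmax x -> vmax y.
Proof. move=> xy mx; have -> : y = x - (x - y) by ring.
exact: vmaxB. Qed.

End ValuationRingTheory.

(** * Regularity of the 2-form at a valuation *)

(** Stated over any commutative ring, so that one formula serves for polynomials, function fields
    and points of the plane. *)
Definition radicand_at (R : comPzRingType) (x y : R) : R :=
  4 * x * y ^+ 2 * (1 + x) ^+ 2
  + (x * (1 + y) ^+ 2 + y * (1 + x) ^+ 2)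
    * (x * (1 - y) ^+ 2 + y * (1 - x) ^+ 2).

Ltac vring_solve OP := repeat first
  [ assumption | apply: (vring1 OP) | apply: (vring0 OP) | apply: (vring_nat OP)
  | apply: (vringD OP) | apply: (vringN OP) | apply: (vringM OP)
  | apply: (vringX OP) ].

Ltac veq_solve OP := repeat lazymatch goal with
  | |- veq _ ?x ?x => exact: veq_refl
  | |- veq _ (_ + _) _ => apply: (veqD OP)
  | |- veq _ (_ * _) _ => apply: (veqM OP)
  | |- veq _ (- _) _ => apply: (veqN OP)
  | |- veq _ (_ ^+ _) _ => apply: (veqX OP)
  | |- veq _ _ _ => assumption
  | |- _ => vring_solve OP
  end.

(** Applies an arbitrary derivation to an equation [r ^+ 2 = g] and expands, which checks the
    claimed partial derivatives of [g]. *)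
Ltac derivation_solve E := let d := fresh "d" in let dP := fresh "dP" in
  move=> d dP; move/(congr1 d): (E); rewrite (der_sqr dP) => ->;
  rewrite !(derD dP, derN dP, der_sqr dP, derM dP, der_natr dP,
            der1 dP); ring.

Section TwoForm.
Variables (F : fieldType) (O : F -> Prop) (d1 d2 : F -> F).
Hypothesis OP : valuation_ring O.
Hypothesis OV : forall n, O n.+1%:R^-1.
Hypothesis char0 : forall n, n.+1%:R != 0 :> F.
Hypotheses (d1P : is_derivation d1) (d2P : is_derivation d2).
Hypotheses (d1O : forall x, O x -> O (d1 x)) (d2O : forall x, O x -> O (d2 x)).

Local Notation J := (jacobian d1 d2).
Local Notation vmax := (vmax O).
Local Notation veq := (veq O).

(** The residue field has characteristic 0. The chart computations reach their contradictions by
    placing a positive integer in the maximal ideal. *)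
Lemma vmax_natr n : ~ vmax n.+1%:R.
Proof. exact: (vmaxNV (char0 n) (OV n)). Qed.

Lemma vmax_natMl n x : O x -> vmax (n.+1%:R * x) -> vmax x.
Proof.
move=> Ox; case/(vmax_prime OP) => //; first exact: vring_nat.
by move/vmax_natr.
Qed.

Lemma jacobian_vring a b : O a -> O b -> O (J a b).
Proof.
move=> Oa Ob; rewrite /jacobian; apply: (vringB OP); apply: (vringM OP); auto.
Qed.

Lemma unit_chart a b r : O a -> O b -> O r -> ~ vmax r -> O (J a b / r).
Proof.
move=> Oa Ob Or nr; case: (vmaxVP OP Or) => // -[_ OVr].
by apply: (vringM OP) => //; apply: jacobian_vring.
Qed.

(* In the local coordinates [(r, b)] the form [da db / r] equals
   [2 dr db / ga]; similarly for [(a, r)]. *)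
Lemma smooth_chart a b r ga gb :
    O a -> O b -> O r -> O ga -> O gb ->
    (forall d, is_derivation d -> 2 * r * d r = ga * d a + gb * d b) ->
    ~ [/\ vmax r, vmax ga & vmax gb] ->
  O (J a b / r).
Proof.
move=> Oa Ob Or Oga Ogb dr nsing.
have [->|r0] := eqVneq r 0; first by rewrite invr0 mulr0; apply: (vring0 OP).
case: (vmaxVP OP Or) => [mr|[_ OVr]]; last first.
  by apply: (vringM OP) => //; apply: jacobian_vring.
have O2 : O 2 by apply: (vring_nat OP).
have E1 := dr _ d1P; have E2 := dr _ d2P.
case: (vmaxVP OP Oga) => [mga|[ga0 OVga]].
  case: (vmaxVP OP Ogb) => [mgb|[gb0 OVgb]]; first by case: nsing.
  suff -> : J a b / r = 2 * J a r / gb.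
    by do 2!apply: (vringM OP) => //; apply: jacobian_vring.
  have H : J a b * gb = 2 * r * J a r.
    have -> : 2 * r * J a r = d1 a * (2 * r * d2 r) - d2 a * (2 * r * d1 r).
      by rewrite /jacobian; ring.
    by rewrite E1 E2 /jacobian; ring.
  by apply: (canRL (mulfK gb0)); rewrite mulrAC H; field.
suff -> : J a b / r = 2 * J r b / ga.
  by do 2!apply: (vringM OP) => //; apply: jacobian_vring.
have H : J a b * ga = 2 * r * J r b.
  have -> : 2 * r * J r b = (2 * r * d1 r) * d2 b - (2 * r * d2 r) * d1 b.
    by rewrite /jacobian; ring.
  by rewrite E1 E2 /jacobian; ring.
by apply: (canRL (mulfK ga0)); rewrite mulrAC H; field.
Qed.

(** * Blow-ups at the singular points of the branch curve *)

Lemma jacobianC a b : J a b = - J b a.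
Proof. by rewrite /jacobian; ring. Qed.

(** Since [d(bc) db = b dc db], the factor [b] is absorbed by [r / b]: blowing up a double point of
    the branch curve keeps the shape of the form and creates no pole along the exceptional
    divisor. *)
Lemma blowupl c b r : (b != 0 -> O (J c b / (r / b))) -> O (J (b * c) b / r).
Proof.
move=> H; have [b_0|b0] := eqVneq b 0.
  rewrite b_0 mul0r /jacobian (der0 d1P) (der0 d2P) !mulr0 subrr mul0r.
  exact: (vring0 OP).
suff -> : J (b * c) b / r = J c b / (r / b) by exact: H.
rewrite /jacobian !(derM d1P, derM d2P).
by rewrite invfM invrK; ring.
Qed.

Lemma blowupr a c r : (a != 0 -> O (J a c / (r / a))) -> O (J a (a * c) / r).
Proof.
move=> H; rewrite jacobianC mulNr; apply: (vringN OP); apply: blowupl => a0.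
by rewrite jacobianC mulNr; apply: (vringN OP); apply: H.
Qed.

(** The valuation is centred in one of the two affine charts of the blow-up of [a = b = 0]. *)
Lemma vring_div a b : exists2 c, O c & a = b * c \/ b = a * c.
Proof.
have [->|b0] := eqVneq b 0.
  by exists 0; [exact: (vring0 OP) | right; rewrite mulr0].
case: (vring_total OP (a / b)) => [H|]; first by exists (a / b) => //; left; field.
rewrite invfM invrK => H.
have [->|a0] := eqVneq a 0.
  by exists 0; [exact: (vring0 OP) | left; rewrite mulr0].
by exists (a^-1 * b) => //; right; field.
Qed.

Lemma veq0 x : vmax x -> veq x 0.
Proof. by rewrite /veq subr0. Qed.

Lemma vring_root (r g : F) : r ^+ 2 = g -> O g -> O r.
Proof. by move=> <-; apply: (vring_sqr OP). Qed.

Lemma div_sqr_eq (r b g : F) : b != 0 -> r ^+ 2 = b ^+ 2 * g -> (r / b) ^+ 2 = g.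
Proof. by move=> b0 E; rewrite expr_div_n E; field. Qed.

(* In the charts below [g] is the strict transform of the branch curve, and
   [gc], [gx], ... are its partial derivatives; singular points on the
   exceptional divisor are excluded by reducing modulo the maximal ideal. *)
Lemma A2_chart x y r : vmax x -> vmax y -> r ^+ 2 = radicand_at x y ->
  O (J x y / r).
Proof.
move=> mx my E.
case: (vring_div x y) => c Oc [Ex|Ey].
  rewrite Ex; apply: blowupl => y0.
  pose g (c y : F) :=
    (c + 1) ^+ 2 * (1 + y ^+ 2 * c) ^+ 2 + 4 * y * c * (1 - y * c) ^+ 2.
  have E1 : (r / y) ^+ 2 = g c y.
    by apply: div_sqr_eq => //; rewrite E Ex /radicand_at /g; ring.
  move: (r / y) E1 => r1 E1; have Oy := vmaxO OP my; have y_0 := veq0 my.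
  have Or1 : O r1 by apply: (vring_root E1); rewrite /g; vring_solve OP.
  pose gc (c y : F) := 2 * (c + 1) * (1 + y ^+ 2 * c) ^+ 2
    + (c + 1) ^+ 2 * (2 * (1 + y ^+ 2 * c) * y ^+ 2)
    + 4 * y * (1 - y * c) ^+ 2 - 8 * y ^+ 2 * c * (1 - y * c).
  pose gy (c y : F) := (c + 1) ^+ 2 * (4 * (1 + y ^+ 2 * c) * y * c)
    + 4 * c * (1 - y * c) ^+ 2 - 8 * y * c ^+ 2 * (1 - y * c).
  apply: (@smooth_chart _ _ _ (gc c y) (gy c y)) => //.
  - by rewrite /gc; vring_solve OP.
  - by rewrite /gy; vring_solve OP.
  - by rewrite /gc /gy; rewrite /g in E1; derivation_solve E1.
  (* On the exceptional divisor [y = 0] the strict transform of the cusp is [(c + 1)^2], a tangency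
     at [c = -1]; the derivative [gy] is there [4 c], a unit at that point. *)
  case=> mr _ mgy.
  have mg : vmax (g c 0).
    apply: (vmax_veq OP _ (vmaxX OP 1 mr)); rewrite E1 /g; veq_solve OP.
  have {mgy} : vmax (gy c 0).
    apply: (vmax_veq OP _ mgy); rewrite /gy; veq_solve OP.
  have -> : gy c 0 = 4 * c by rewrite /gy; ring.
  move/vmax_natMl => /(_ Oc) mc.
  have {mg} : vmax (c + 1).
    apply: (vmax_sqr OP); first by vring_solve OP.
    by suff <- : g c 0 = (c + 1) ^+ 2 by []; rewrite /g; ring.
  move=> mc1; apply: (@vmax_natr 0).
  have -> : 1%:R = (c + 1) - c by ring.
  exact: (vmaxB OP).
rewrite Ey; apply: blowupr => x0.
pose g (c x : F) :=
  (c + 1) ^+ 2 * (1 + x ^+ 2 * c) ^+ 2 + 4 * x * c ^+ 2 * (1 - x) ^+ 2.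
have E1 : (r / x) ^+ 2 = g c x.
  by apply: div_sqr_eq => //; rewrite E Ey /radicand_at /g; ring.
move: (r / x) E1 => r1 E1; have Ox := vmaxO OP mx; have x_0 := veq0 mx.
have Or1 : O r1 by apply: (vring_root E1); rewrite /g; vring_solve OP.
pose gc (c x : F) := 2 * (c + 1) * (1 + x ^+ 2 * c) ^+ 2
  + (c + 1) ^+ 2 * (2 * (1 + x ^+ 2 * c) * x ^+ 2)
  + 8 * x * c * (1 - x) ^+ 2.
pose gx (c x : F) := (c + 1) ^+ 2 * (4 * (1 + x ^+ 2 * c) * x * c)
  + 4 * c ^+ 2 * (1 - x) ^+ 2 - 8 * x * c ^+ 2 * (1 - x).
apply: (@smooth_chart _ _ _ (gx c x) (gc c x)) => //.
- by rewrite /gx; vring_solve OP.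
- by rewrite /gc; vring_solve OP.
- by rewrite /gc /gx; rewrite /g in E1; derivation_solve E1.
case=> mr mgx _.
have mg : vmax (g c 0).
  apply: (vmax_veq OP _ (vmaxX OP 1 mr)); rewrite E1 /g; veq_solve OP.
have {mgx} : vmax (gx c 0).
  apply: (vmax_veq OP _ mgx); rewrite /gx; veq_solve OP.
have -> : gx c 0 = 4 * c ^+ 2 by rewrite /gx; ring.
move/vmax_natMl => /(_ (vringX OP 2 Oc)) /(vmax_sqr OP Oc) mc.
have {mg} : vmax (c + 1).
  apply: (vmax_sqr OP); first by vring_solve OP.
  by suff <- : g c 0 = (c + 1) ^+ 2 by []; rewrite /g; ring.
move=> mc1; apply: (@vmax_natr 0).
have -> : 1%:R = (c + 1) - c by ring.
exact: (vmaxB OP).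
Qed.

(** The branch curve has a node here: in the two charts its strict transform meets the exceptional
    divisor in the roots of [4 c^2 + 8] and of [8 c^2 + 4]. These are simple, so one blow-up
    suffices. *)
Lemma A1_chart a b r : vmax a -> vmax b ->
  r ^+ 2 = radicand_at (a - 1) (b - 1) -> O (J a b / r).
Proof.
move=> ma mb E.
case: (vring_div a b) => c Oc [Ea|Eb].
  rewrite Ea; apply: blowupl => b0.
  pose A (c b : F) := (b - 1) * c ^+ 2 + (b * c - 1).
  pose g (c b : F) := b ^+ 2 * A c b ^+ 2
    - 4 * (b * c - 1) * (b - 1) ^+ 2 * c ^+ 2 - 8 * (b * c - 1) ^+ 2 * (b - 1).
  have E1 : (r / b) ^+ 2 = g c b.
    by apply: div_sqr_eq => //; rewrite E Ea /radicand_at /g /A; ring.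
  move: (r / b) E1 => r1 E1; have Ob := vmaxO OP mb; have b_0 := veq0 mb.
  have Or1 : O r1 by apply: (vring_root E1); rewrite /g /A; vring_solve OP.
  pose gc (c b : F) := 2 * b ^+ 2 * A c b * (2 * (b - 1) * c + b)
    - 4 * b * (b - 1) ^+ 2 * c ^+ 2 - 8 * (b * c - 1) * (b - 1) ^+ 2 * c
    - 16 * b * (b * c - 1) * (b - 1).
  pose gb (c b : F) := 2 * b * A c b ^+ 2 + 2 * b ^+ 2 * A c b * (c ^+ 2 + c)
    - 4 * c * (b - 1) ^+ 2 * c ^+ 2 - 8 * (b * c - 1) * (b - 1) * c ^+ 2
    - 16 * c * (b * c - 1) * (b - 1) - 8 * (b * c - 1) ^+ 2.
  apply: (@smooth_chart _ _ _ (gc c b) (gb c b)) => //.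
  - by rewrite /gc /A; vring_solve OP.
  - by rewrite /gb /A; vring_solve OP.
  - by rewrite /gc /gb; rewrite /g in E1; rewrite /A in E1 *; derivation_solve E1.
  case=> mr mgc _.
  have mg : vmax (g c 0).
    apply: (vmax_veq OP _ (vmaxX OP 1 mr)); rewrite E1 /g /A; veq_solve OP.
  have {mgc} : vmax (gc c 0).
    apply: (vmax_veq OP _ mgc); rewrite /gc /A; veq_solve OP.
  have -> : gc c 0 = 8 * c by rewrite /gc; ring.
  move/vmax_natMl => /(_ Oc) mc; apply: (@vmax_natr 7).
  have -> : 8%:R = g c 0 - 4 * c * c by rewrite /g; ring.
  by apply: (vmaxB OP) => //; apply: (vmaxMr OP) => //; vring_solve OP.
rewrite Eb; apply: blowupr => a0.
pose A (c a : F) := (a * c - 1) + (a - 1) * c ^+ 2.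
pose g (c a : F) := a ^+ 2 * A c a ^+ 2
  - 4 * (a - 1) * (a * c - 1) ^+ 2 - 8 * (a - 1) ^+ 2 * (a * c - 1) * c ^+ 2.
have E1 : (r / a) ^+ 2 = g c a.
  by apply: div_sqr_eq => //; rewrite E Eb /radicand_at /g /A; ring.
move: (r / a) E1 => r1 E1; have Oa := vmaxO OP ma; have a_0 := veq0 ma.
have Or1 : O r1 by apply: (vring_root E1); rewrite /g /A; vring_solve OP.
pose gc (c a : F) := 2 * a ^+ 2 * A c a * (a + 2 * (a - 1) * c)
  - 8 * a * (a - 1) * (a * c - 1) - 8 * (a - 1) ^+ 2 * a * c ^+ 2
  - 16 * (a - 1) ^+ 2 * (a * c - 1) * c.
pose ga (c a : F) := 2 * a * A c a ^+ 2 + 2 * a ^+ 2 * A c a * (c + c ^+ 2)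
  - 4 * (a * c - 1) ^+ 2 - 8 * (a - 1) * (a * c - 1) * c
  - 16 * (a - 1) * (a * c - 1) * c ^+ 2 - 8 * (a - 1) ^+ 2 * c * c ^+ 2.
apply: (@smooth_chart _ _ _ (ga c a) (gc c a)) => //.
- by rewrite /ga /A; vring_solve OP.
- by rewrite /gc /A; vring_solve OP.
- by rewrite /gc /ga; rewrite /g in E1; rewrite /A in E1 *; derivation_solve E1.
case=> mr _ mgc.
have mg : vmax (g c 0).
  apply: (vmax_veq OP _ (vmaxX OP 1 mr)); rewrite E1 /g /A; veq_solve OP.
have {mgc} : vmax (gc c 0).
  apply: (vmax_veq OP _ mgc); rewrite /gc /A; veq_solve OP.
have -> : gc c 0 = 16 * c by rewrite /gc; ring.
move/vmax_natMl => /(_ Oc) mc; apply: (@vmax_natr 3).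
have -> : 4%:R = g c 0 - 8 * c * c by rewrite /g; ring.
by apply: (vmaxB OP) => //; apply: (vmaxMr OP) => //; vring_solve OP.
Qed.

(** The branch curve has a tacnode here, and two blow-ups are made. In the chart [b = a * c] the new
    root is a unit. In the chart [a = b * c] its square reduces to [4 c^2], so only [c = 0] matters;
    the leading form there is [b^2 + 4 c^2], a node, which the second blow-up resolves. *)
Lemma A3_chart a b r : vmax a -> vmax b ->
  r ^+ 2 = radicand_at (1 + a) (b - 1) -> O (J a b / r).
Proof.
move=> ma mb E; have Oa := vmaxO OP ma; have Ob := vmaxO OP mb.
have b_0 := veq0 mb; have a_0 := veq0 ma.
case: (vring_div a b) => c Oc [Ea|Eb]; last first.
  rewrite Eb; apply: blowupr => a0.
  pose g (c a : F) := a ^+ 2 * ((1 + a) * c ^+ 2 + (a * c - 1)) ^+ 2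
    + 4 * (1 + a) * (a * c - 1) ^+ 2.
  have E1 : (r / a) ^+ 2 = g c a.
    by apply: div_sqr_eq => //; rewrite E Eb /radicand_at /g; ring.
  move: (r / a) E1 => r1 E1.
  have Or1 : O r1 by apply: (vring_root E1); rewrite /g; vring_solve OP.
  apply: unit_chart => // mr; apply: (@vmax_natr 3).
  have -> : 4%:R = g c 0 by rewrite /g; ring.
  apply: (vmax_veq OP _ (vmaxX OP 1 mr)); rewrite E1 /g; veq_solve OP.
rewrite Ea; apply: blowupl => b0.
pose g (c b : F) := b ^+ 2 * ((1 + b * c) + (b - 1) * c ^+ 2) ^+ 2
  + 4 * (1 + b * c) * (b - 1) ^+ 2 * c ^+ 2.
have E1 : (r / b) ^+ 2 = g c b.
  by apply: div_sqr_eq => //; rewrite E Ea /radicand_at /g; ring.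
move: (r / b) E1 => r1 E1.
have Or1 : O r1 by apply: (vring_root E1); rewrite /g; vring_solve OP.
have [mr|nmr] := EM (vmax r1); last exact: unit_chart.
have mc : vmax c.
  have : vmax (g c 0).
    apply: (vmax_veq OP _ (vmaxX OP 1 mr)); rewrite E1 /g; veq_solve OP.
  have -> : g c 0 = 4 * c ^+ 2 by rewrite /g; ring.
  by move/vmax_natMl => /(_ (vringX OP 2 Oc)) /(vmax_sqr OP Oc).
have c_0 := veq0 mc.
case: (vring_div c b) => e Oe [Ec|Eb].
  rewrite Ec; apply: blowupl => _.
  pose A (e b : F) := (1 + b ^+ 2 * e) + (b - 1) * b ^+ 2 * e ^+ 2.
  pose g2 (e b : F) :=
    A e b ^+ 2 + 4 * (1 + b ^+ 2 * e) * (b - 1) ^+ 2 * e ^+ 2.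
  have E2 : (r1 / b) ^+ 2 = g2 e b.
    by apply: div_sqr_eq => //; rewrite E1 Ec /g /g2 /A; ring.
  move: (r1 / b) E2 => r2 E2.
  have Or2 : O r2 by apply: (vring_root E2); rewrite /g2 /A; vring_solve OP.
  pose ge (e b : F) := 2 * A e b * (b ^+ 2 + 2 * (b - 1) * b ^+ 2 * e)
    + 4 * b ^+ 2 * (b - 1) ^+ 2 * e ^+ 2
    + 8 * (1 + b ^+ 2 * e) * (b - 1) ^+ 2 * e.
  pose gb (e b : F) :=
    2 * A e b * (2 * b * e + (3 * b ^+ 2 - 2 * b) * e ^+ 2)
    + 8 * b * e * (b - 1) ^+ 2 * e ^+ 2
    + 8 * (1 + b ^+ 2 * e) * (b - 1) * e ^+ 2.
  apply: (@smooth_chart _ _ _ (ge e b) (gb e b)) => //.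
  - by rewrite /ge /A; vring_solve OP.
  - by rewrite /gb /A; vring_solve OP.
  - by rewrite /ge /gb; rewrite /g2 in E2; rewrite /A in E2 *; derivation_solve E2.
  case=> mr2 mge _.
  have mg : vmax (g2 e 0).
    apply: (vmax_veq OP _ (vmaxX OP 1 mr2)); rewrite E2 /g2 /A; veq_solve OP.
  have {mge} : vmax (ge e 0).
    apply: (vmax_veq OP _ mge); rewrite /ge /A; veq_solve OP.
  have -> : ge e 0 = 8 * e by rewrite /ge; ring.
  move/vmax_natMl => /(_ Oe) me; apply: (@vmax_natr 0).
  have -> : 1%:R = g2 e 0 - 4 * e * e by rewrite /g2 /A; ring.
  by apply: (vmaxB OP) => //; apply: (vmaxMr OP) => //; vring_solve OP.
rewrite Eb; apply: blowupr => c0.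
pose A (e c : F) := (1 + c ^+ 2 * e) + (c * e - 1) * c ^+ 2.
pose g2 (e c : F) :=
  e ^+ 2 * A e c ^+ 2 + 4 * (1 + c ^+ 2 * e) * (c * e - 1) ^+ 2.
have E2 : (r1 / c) ^+ 2 = g2 e c.
  by apply: div_sqr_eq => //; rewrite E1 Eb /g /g2 /A; ring.
move: (r1 / c) E2 => r2 E2.
have Or2 : O r2 by apply: (vring_root E2); rewrite /g2 /A; vring_solve OP.
pose ge (e c : F) := 2 * e * A e c ^+ 2
  + 2 * e ^+ 2 * A e c * (c ^+ 2 + c * c ^+ 2)
  + 4 * c ^+ 2 * (c * e - 1) ^+ 2 + 8 * (1 + c ^+ 2 * e) * (c * e - 1) * c.
pose gc (e c : F) :=
  2 * e ^+ 2 * A e c * (2 * c * e + e * c ^+ 2 + 2 * (c * e - 1) * c)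
  + 8 * c * e * (c * e - 1) ^+ 2 + 8 * (1 + c ^+ 2 * e) * (c * e - 1) * e.
apply: (@smooth_chart _ _ _ (gc e c) (ge e c)) => //.
- by rewrite /gc /A; vring_solve OP.
- by rewrite /ge /A; vring_solve OP.
- by rewrite /ge /gc; rewrite /g2 in E2; rewrite /A in E2 *; derivation_solve E2.
case=> mr2 _ mge.
have mg : vmax (g2 e 0).
  apply: (vmax_veq OP _ (vmaxX OP 1 mr2)); rewrite E2 /g2 /A; veq_solve OP.
have {mge} : vmax (ge e 0).
  apply: (vmax_veq OP _ mge); rewrite /ge /A; veq_solve OP.
have -> : ge e 0 = 2 * e by rewrite /ge /A; ring.
move/vmax_natMl => /(_ Oe) me; apply: (@vmax_natr 3).
have -> : 4%:R = g2 e 0 - e * e by rewrite /g2 /A; ring.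
by apply: (vmaxB OP) => //; apply: (vmaxMr OP).
Qed.

(* [radicand_at x y = radicand_root x y ^+ 2 + 4 * x * y ^+ 2 * (x - 1) ^+ 2],
   and [radicand_x], [radicand_y] are its partial derivatives. *)
Definition radicand_root (x y : F) := (x + y) * (1 + x * y).

Definition radicand_x (x y : F) :=
  2 * radicand_root x y * ((1 + x * y) + y * (x + y)) + 4 * y ^+ 2 * (x - 1) ^+ 2
  + 8 * x * y ^+ 2 * (x - 1).

Definition radicand_y (x y : F) :=
  2 * radicand_root x y * ((1 + x * y) + x * (x + y)) + 8 * x * y * (x - 1) ^+ 2.

(** Write [f] for the radicand, with [X = x + 1/x] and [Y = y + 1/y]. Then [x f_x - 2 f] and
    [y f_y - 2 f] are [x^2 y^2] times the images of [(X + Y)^2 + 4 X - 8] under [x d/dx] and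
    [y d/dy], hence carry the factors [x^2 - 1] and [y^2 - 1]. Both vanish in the residue field, and
    each resulting case is tested against [f = 0]. *)
Lemma radicand_singular x y : O x -> O y -> vmax (radicand_at x y) ->
    vmax (radicand_x x y) -> vmax (radicand_y x y) ->
  [\/ vmax x /\ vmax y, vmax (x - 1) /\ vmax (y + 1)
    | vmax (x + 1) /\ vmax (y + 1)].
Proof.
move=> Ox Oy mf mfx mfy.
have [mx|nx] := EM (vmax x).
  constructor 1; split=> //; apply: (vmax_sqr OP Oy).
  have x_0 := veq0 mx.
  have -> : y ^+ 2 = radicand_at 0 y by rewrite /radicand_at; ring.
  apply: (vmax_veq OP _ mf); rewrite /radicand_at; veq_solve OP.
have [my|ny] := EM (vmax y).
  case: nx; apply: (vmax_sqr OP Ox).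
  have y_0 := veq0 my.
  have -> : x ^+ 2 = radicand_at x 0 by rewrite /radicand_at; ring.
  apply: (vmax_veq OP _ mf); rewrite /radicand_at; veq_solve OP.
have O2 n : O n%:R by apply: (vring_nat OP).
have Hy : vmax (radicand_root x y) \/ vmax (y - 1) \/ vmax (y + 1).
  have : vmax (2%:R * (x * (radicand_root x y * ((y - 1) * (y + 1))))).
    have -> : 2%:R * (x * (radicand_root x y * ((y - 1) * (y + 1))))
        = y * radicand_y x y - 2 * radicand_at x y.
      by rewrite /radicand_root /radicand_y /radicand_at /radicand_root; ring.
    by apply: (vmaxB OP); apply: (vmaxMr OP).
  move/vmax_natMl => H.
  have {H} := H _ => /(_ _)/(vmax_prime OP Ox) H.
  have {H} : vmax (radicand_root x y * ((y - 1) * (y + 1))).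
    by case: H => //; rewrite /radicand_root; vring_solve OP.
  case/(vmax_prime OP); [by rewrite /radicand_root; vring_solve OP | by vring_solve OP | by left | ].
  by move/(vmax_prime OP) => H; right; apply: H; vring_solve OP.
have Hx : [\/ vmax (radicand_root x y + 2 * x * y), vmax (x - 1) | vmax (x + 1)].
  have : vmax (2%:R * (y * ((radicand_root x y + 2 * x * y) * ((x - 1) * (x + 1))))).
    have -> : 2%:R * (y * ((radicand_root x y + 2 * x * y) * ((x - 1) * (x + 1))))
        = x * radicand_x x y - 2 * radicand_at x y.
      by rewrite /radicand_root /radicand_x /radicand_at /radicand_root; ring.
    by apply: (vmaxB OP); apply: (vmaxMr OP).
  move/vmax_natMl => H.
  have {H} := H _ => /(_ _)/(vmax_prime OP Oy) H.
  have {H} : vmax ((radicand_root x y + 2 * x * y) * ((x - 1) * (x + 1))).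
    by case: H => //; rewrite /radicand_root; vring_solve OP.
  case/(vmax_prime OP); [by rewrite /radicand_root; vring_solve OP | by vring_solve OP | by constructor 1 | ].
  move/(vmax_prime OP) => [||H|H]; try by vring_solve OP.
    by constructor 2.
  by constructor 3.
have nx2 n : ~ vmax (n.+1%:R * x ^+ 2).
  by move/vmax_natMl => /(_ (vringX OP 2 Ox)) /(vmax_sqr OP Ox).
case: Hy => [mP|[my1|my1]].
- have mx1 : vmax (x - 1).
    have : vmax (4%:R * (x * (y * (x - 1)) ^+ 2)).
      have -> : 4%:R * (x * (y * (x - 1)) ^+ 2)
          = radicand_at x y - radicand_root x y * radicand_root x y.
        by rewrite /radicand_at /radicand_root; ring.
      by apply: (vmaxB OP) => //; apply: (vmaxMr OP) => //; apply: (vmaxO OP).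
    have Oyx : O (y * (x - 1)) by vring_solve OP.
    move/vmax_natMl => /(_ (vringM OP Ox (vringX OP 2 Oyx))).
    case/(vmax_prime OP) => //; first exact: (vringX OP).
    by case/(vmax_sqr OP Oyx)/(vmax_prime OP) => //; vring_solve OP.
  constructor 2; split=> //; have x_1 : veq x 1 by [].
  apply: (vmax_sqr OP); first by vring_solve OP.
  have -> : (y + 1) ^+ 2 = radicand_root 1 y by rewrite /radicand_root; ring.
  apply: (vmax_veq OP _ mP); rewrite /radicand_root; veq_solve OP.
- have y_1 : veq y 1 by [].
  have mf1 : vmax (radicand_at x 1).
    apply: (vmax_veq OP _ mf); rewrite /radicand_at; veq_solve OP.
  case: Hx => [mQ|mx1|mx1].
  + have mQ1 : vmax (radicand_root x 1 + 2 * x * 1).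
      apply: (vmax_veq OP _ mQ); rewrite /radicand_root; veq_solve OP.
    (* Here [Y = 2] and [X + Y + 2 = 0], so [X = -4] and [(X + Y)^2 + 4 X - 8 = -20]. *)
    case: (nx2 19).
    have -> : 20%:R * x ^+ 2 = (radicand_root x 1 + 2 * x * 1) * (radicand_root x 1 + 2 * x * 1)
        - radicand_at x 1 by rewrite /radicand_root /radicand_at; ring.
    by apply: (vmaxB OP) => //; apply: (vmaxMr OP) => //; apply: (vmaxO OP).
  + have x_1 : veq x 1 by [].
    case: (@vmax_natr 15).
    have -> : 16%:R = radicand_at 1 1 :> F by rewrite /radicand_at; ring.
    apply: (vmax_veq OP _ mf1); rewrite /radicand_at; veq_solve OP.
  + have x_1 : veq x (-1) by rewrite /veq opprK.
    case: (@vmax_natr 15).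
    have -> : 16%:R = - radicand_at (-1) 1 :> F by rewrite /radicand_at; ring.
    apply: (vmaxN OP); apply: (vmax_veq OP _ mf1); rewrite /radicand_at.
    veq_solve OP.
- have y_1 : veq y (-1) by rewrite /veq opprK.
  case: Hx => [mQ|mx1|mx1]; [|by constructor 2|by constructor 3].
  have mf1 : vmax (radicand_at x (-1)).
    apply: (vmax_veq OP _ mf); rewrite /radicand_at; veq_solve OP.
  have mQ1 : vmax (radicand_root x (-1) + 2 * x * -1).
    apply: (vmax_veq OP _ mQ); rewrite /radicand_root; veq_solve OP.
  (* Here [Y = -2] and [X + Y + 2 = 0], so [X = 0] and [(X + Y)^2 + 4 X - 8 = -4]. *)
  case: (nx2 3).
  have -> : 4%:R * x ^+ 2 =
      (radicand_root x (-1) + 2 * x * -1) * (radicand_root x (-1) + 2 * x * -1)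
      - radicand_at x (-1) by rewrite /radicand_root /radicand_at; ring.
  by apply: (vmaxB OP) => //; apply: (vmaxMr OP) => //; apply: (vmaxO OP).
Qed.

Lemma affine_chart x y r : O x -> O y -> r ^+ 2 = radicand_at x y ->
  O (J x y / r).
Proof.
move=> Ox Oy E.
have Or : O r by apply: (vring_root E); rewrite /radicand_at; vring_solve OP.
have [[mr mfx mfy]|nsing] := EM [/\ vmax r, vmax (radicand_x x y)
    & vmax (radicand_y x y)]; last first.
  apply: (@smooth_chart _ _ _ (radicand_x x y) (radicand_y x y)) => //.
  - by rewrite /radicand_x /radicand_root; vring_solve OP.
  - by rewrite /radicand_y /radicand_root; vring_solve OP.
  by rewrite /radicand_x /radicand_y /radicand_root; rewrite /radicand_at in E;
    derivation_solve E.
have mf : vmax (radicand_at x y) by rewrite -E; apply: (vmaxX OP).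
case: (radicand_singular Ox Oy mf mfx mfy) => -[mx my].
- exact: A2_chart.
- suff -> : J x y = J (x - 1) (y + 1).
    apply: A3_chart => //; by rewrite E; congr radicand_at; ring.
  by rewrite /jacobian !(derB d1P, derB d2P, derD d1P, derD d2P,
    der1 d1P, der1 d2P) !subr0 !addr0.
- suff -> : J x y = J (x + 1) (y + 1).
    apply: A1_chart => //; by rewrite E; congr radicand_at; ring.
  by rewrite /jacobian !(derD d1P, derD d2P, der1 d1P, der1 d2P) !addr0.
Qed.

Lemma radicand_invl (x y : F) : x != 0 ->
  radicand_at x^-1 y = radicand_at x y / x ^+ 4.
Proof. by move=> x0; rewrite /radicand_at; field. Qed.

Lemma radicand_invr (x y : F) : y != 0 ->
  radicand_at x y^-1 = radicand_at x y / y ^+ 4.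
Proof. by move=> y0; rewrite /radicand_at; field. Qed.

(** Replacing [x] by [1/x] multiplies [dx] by [-1/x^2] and turns the root [r] into [r / x^2], so the
    form only changes sign; likewise for [y]. This reduces every centre on the product of two
    projective lines to the affine chart. For [r = 0] the quotient is 0 by convention. *)
Theorem two_form_regular x y r : r ^+ 2 = radicand_at x y -> O (J x y / r).
Proof.
have Hx y' x' r' : O y' -> r' ^+ 2 = radicand_at x' y' -> O (J x' y' / r').
  move=> Oy E; case: (vring_total OP x') => Ox; first exact: affine_chart.
  have [x0|x0] := eqVneq x' 0.
    by apply: affine_chart => //; rewrite x0; apply: (vring0 OP).
  have -> : J x' y' / r' = - (J x'^-1 y' / (r' / x' ^+ 2)).
    rewrite /jacobian !(der_inv d1P, der_inv d2P) [(r' / _)^-1]invfM.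
    by rewrite invrK; move: (r'^-1) => ri; field.
  apply: (vringN OP); apply: affine_chart => //.
  by rewrite radicand_invl // expr_div_n E; field.
move=> E; case: (vring_total OP y) => Oy; first exact: Hx.
have [y0|y0] := eqVneq y 0.
  by apply: Hx => //; rewrite y0; apply: (vring0 OP).
have -> : J x y / r = - (J x y^-1 / (r / y ^+ 2)).
  rewrite /jacobian !(der_inv d1P, der_inv d2P) [(r / _)^-1]invfM.
  by rewrite invrK; move: (r^-1) => ri; field.
apply: (vringN OP); apply: Hx => //.
by rewrite radicand_invr // expr_div_n E; field.
Qed.

End TwoForm.

(** * Fraction fields *)

Local Open Scope quotient_scope.

(** The primed letters stand for derivatives but are free variables, so that additivity of the
    quotient rule becomes a pure field identity. *)
Lemma quotient_ruleD (F : fieldType) (a b c e a' b' c' e' : F) :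
  b != 0 -> e != 0 ->
  ((a' * e + a * e' + (c' * b + c * b')) * (b * e)
    - (a * e + c * b) * (b' * e + b * e')) / (b * e) ^+ 2
  = (a' * b - a * b') / b ^+ 2 + (c' * e - c * e') / e ^+ 2.
Proof. by move=> b0 e0; field; rewrite ?b0 ?e0. Qed.

Lemma quotient_ruleM (F : fieldType) (a b c e a' b' c' e' : F) :
  b != 0 -> e != 0 ->
  ((a' * c + a * c') * (b * e) - a * c * (b' * e + b * e')) / (b * e) ^+ 2
  = (a' * b - a * b') / b ^+ 2 * (c / e) + a / b * ((c' * e - c * e') / e ^+ 2).
Proof. by move=> b0 e0; field; rewrite ?b0 ?e0. Qed.

Section Fractions.
Variable R : idomainType.
Local Notation "x %:F" := (@FracField.tofrac R x).

Lemma fractionP (x : {fraction R}) :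
  exists nd : R * R, nd.2 != 0 /\ x = nd.1%:F / nd.2%:F.
Proof.
elim/quotW: x => x; exists (frac x); split; first exact: denom_ratioP.
have d0 : (frac x).2 != 0 by apply: denom_ratioP.
apply: (canRL (mulfK _)); first by rewrite tofrac_eq0.
unlock FracField.tofrac; rewrite -[LHS]FracField.pi_mul; apply/eqmodP => /=.
rewrite FracField.equivfE /FracField.mulf !numden_Ratio ?mulf_neq0 ?oner_neq0 ?mulr1 //.
by rewrite mulrC.
Qed.

Lemma frac_eq (a b c d : R) : b != 0 -> d != 0 ->
  a%:F / b%:F = c%:F / d%:F -> a * d = c * b.
Proof.
move=> b0 d0 E; apply/eqP; rewrite -tofrac_eq !tofracM; apply/eqP.
have bF : b%:F != 0 by rewrite tofrac_eq0.
have dF : d%:F != 0 by rewrite tofrac_eq0.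
by rewrite -[a%:F](divfK bF) E mulrAC divfK // mulrAC.
Qed.

(** The quotient rule is applied to chosen representatives; differentiating the cross-multiplied
    identity [a * m = n * b] shows that the result is independent of the choice, which is [DE]. *)
Lemma frac_derivation (d : R -> R) : is_derivation d ->
  exists2 D : {fraction R} -> {fraction R}, is_derivation D
    & forall a, D a%:F = (d a)%:F.
Proof.
move=> dP; have /choice [nd ndP] := fractionP.
pose D x := let: (n, m) := nd x in (d n * m - n * d m)%:F / m%:F ^+ 2.
have DE a b : b != 0 -> D (a%:F / b%:F) = (d a * b - a * d b)%:F / b%:F ^+ 2.
  move=> b0; rewrite /D; have := ndP (a%:F / b%:F).
  case: (nd _) => n m /= [m0 E].
  have mF : m%:F != 0 by rewrite tofrac_eq0.
  have bF : b%:F != 0 by rewrite tofrac_eq0.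
  have {}E := frac_eq b0 m0 E; have dE : d a * m + a * d m = d n * b + n * d b.
    by rewrite -!(derM dP) E.
  apply: (canRL (mulfK _)); first by rewrite expf_neq0.
  rewrite mulrAC; apply: (canLR (mulfK _)); first by rewrite expf_neq0.
  rewrite -!tofracXn -!tofracM; congr (_%:F).
  have -> : (d n * m - n * d m) * b ^+ 2 =
    (d n * b + n * d b) * m * b - (n * b) * (m * d b + b * d m) by ring.
  by rewrite -dE -E; ring.
exists D => [|a]; last first.
  have := DE a 1 (oner_neq0 _); rewrite tofrac1 expr1n !divr1 => ->.
  by rewrite (der1 dP) mulr1 mulr0 subr0.
split=> x y; have [[a b] /= [b0 ->]] := fractionP x;
  have [[a' b'] /= [b'0 ->]] := fractionP y;
  have bF : b%:F != 0 by rewrite tofrac_eq0.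
  have b'F : b'%:F != 0 by rewrite tofrac_eq0.
  have -> : a%:F / b%:F + a'%:F / b'%:F = (a * b' + a' * b)%:F / (b * b')%:F.
    by rewrite tofracD !tofracM addf_div.
  rewrite !DE ?mulf_neq0 // !(derD dP, derM dP).
  by rewrite !(tofracD, tofracM, tofracN) quotient_ruleD.
have b'F : b'%:F != 0 by rewrite tofrac_eq0.
have -> : (a%:F / b%:F) * (a'%:F / b'%:F) = (a * a')%:F / (b * b')%:F.
  by rewrite !tofracM mulf_div.
rewrite !DE ?mulf_neq0 // !(derD dP, derM dP).
by rewrite !(tofracD, tofracM, tofracN) quotient_ruleM.
Qed.

(** The universal property of the fraction field; it serves to carry [C(s, t)] into the iterated
    field [C(t)(s)]. *)
Lemma frac_rmorphism (F : fieldType) (f : {rmorphism R -> F}) : injective f ->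
  exists g : {rmorphism {fraction R} -> F}, forall a, g a%:F = f a.
Proof.
move=> f_inj; have /choice [nd ndP] := fractionP.
pose g x := f (nd x).1 / f (nd x).2.
have f0 a : a != 0 -> f a != 0 by rewrite -(inj_eq f_inj) rmorph0.
have gE a b : b != 0 -> g (a%:F / b%:F) = f a / f b.
  move=> b0; rewrite /g; have := ndP (a%:F / b%:F).
  case: (nd _) => n m /= [m0 E]; have {}E := frac_eq b0 m0 E.
  apply: (canRL (mulfK (f0 _ b0))); rewrite mulrAC.
  by apply: (canLR (mulfK (f0 _ m0))); rewrite -!rmorphM E.
have gB : zmod_morphism g.
  move=> x y; have [[a b] /= [b0 ->]] := fractionP x.
  have [[a' b'] /= [b'0 ->]] := fractionP y.
  have bF : b%:F != 0 by rewrite tofrac_eq0.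
  have b'F : b'%:F != 0 by rewrite tofrac_eq0.
  have -> : a%:F / b%:F - a'%:F / b'%:F = (a * b' - a' * b)%:F / (b * b')%:F.
    by rewrite tofracB !tofracM -mulNr addf_div // mulNr.
  rewrite !gE ?mulf_neq0 // rmorphB !rmorphM -[in RHS]mulNr addf_div ?f0 //.
  by rewrite mulNr.
have gM : monoid_morphism g.
  split=> [|x y].
    by rewrite -[1](divr1 1) -{1}tofrac1 -{1}tofrac1 gE ?oner_eq0 // rmorph1 divr1.
  have [[a b] /= [b0 ->]] := fractionP x.
  have [[a' b'] /= [b'0 ->]] := fractionP y.
  have bF : b%:F != 0 by rewrite tofrac_eq0.
  have b'F : b'%:F != 0 by rewrite tofrac_eq0.
  have -> : (a%:F / b%:F) * (a'%:F / b'%:F) = (a * a')%:F / (b * b')%:F.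
    by rewrite !tofracM mulf_div.
  by rewrite !gE ?mulf_neq0 // !rmorphM mulf_div.
pose gZ := GRing.isZmodMorphism.Build _ _ g gB.
pose gR := GRing.isMonoidMorphism.Build _ _ g gM.
pose G : {rmorphism {fraction R} -> F} := HB.pack g gZ gR.
exists G => a; rewrite /= -[a%:F]divr1 -tofrac1 gE ?oner_eq0 //.
by rewrite rmorph1 divr1.
Qed.

End Fractions.

(** * Regular 2-forms on a ruled surface *)

Lemma der_div (F : fieldType) (d : F -> F) (dP : is_derivation d) a b :
  b != 0 -> d (a / b) = (d a * b - a * d b) / b ^+ 2.
Proof. by move=> b0; rewrite (derM dP) (der_inv dP); field. Qed.

Lemma derivation_scale (F : fieldType) (d : F -> F) c : is_derivation d ->
  is_derivation (fun x => c * d x).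
Proof. by move=> dP; split=> x y; rewrite ?(derD dP) ?(derM dP); ring. Qed.

Lemma subf_div (F : fieldType) (a b c e : F) : b != 0 -> e != 0 ->
  a / b - c / e = (a * e - c * b) / (b * e).
Proof. by move=> b0 e0; rewrite -mulNr addf_div // mulNr. Qed.

Lemma jacobian_scale (R : comPzRingType) (d1 d2 : R -> R) c x y :
  jacobian (fun z => c * d1 z) d2 x y = c * jacobian d1 d2 x y.
Proof. by rewrite /jacobian; ring. Qed.

Section RationalFunctions.
Variable K : fieldType.
Local Notation "x %:F" := (@FracField.tofrac {poly K} x).
Local Notation F := {fraction {poly K}}.
Implicit Types (p q a b : {poly K}) (x y : F).

Lemma irreducible_divisor b : (1 < size b)%N ->
  exists2 p, irreducible_poly p & p %| b.
Proof.
move: {2}(size b) (leqnn (size b)) => n; elim: n b => [|n IH] b bn b1.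
  by move: b1; rewrite ltnNge (leq_trans bn).
have [irr|nirr] := EM (irreducible_poly b); first by exists b.
have [q [q1 qb nqb]] : exists q, [/\ size q != 1%N, q %| b & ~ q %= b].
  apply: contrapT => nex; apply: nirr; split=> // q q1 qb.
  by apply: contrapT => nqb; apply: nex; exists q.
have b0 : b != 0 by rewrite -size_poly_gt0 (ltn_trans _ b1).
have q0 : q != 0 by apply: contraNneq b0 => q0; rewrite q0 dvd0p in qb.
have qlt : (size q < size b)%N.
  rewrite ltn_neqAle dvdp_leq // andbT.
  by apply/negP => H; apply: nqb; rewrite -(dvdp_size_eqp qb).
have [||p irr pq] := IH q.
- by rewrite -ltnS (leq_trans qlt).
- by rewrite ltn_neqAle eq_sym q1 size_poly_gt0.
by exists p => //; apply: dvdp_trans pq qb.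
Qed.

Lemma irreducible_prime p a b : irreducible_poly p -> p %| a * b ->
  ~~ (p %| a) -> p %| b.
Proof.
by move=> irr + npa; rewrite Gauss_dvdpr // irreducible_poly_coprime.
Qed.

Lemma coprime_ndvdp p a b : irreducible_poly p -> coprimep a b ->
  p %| a -> ~~ (p %| b).
Proof.
move=> [p1 _] /coprimepP cab pa; apply/negP => pb.
by move: (cab p pa pb) p1; rewrite -size_poly_eq1 => /eqP->.
Qed.

Lemma reduced_fraction x :
  exists a b, [/\ b != 0, coprimep a b & x = a%:F / b%:F].
Proof.
have [[a b] /= [b0 ->]] := fractionP x; pose g := gcdp a b.
have g0 : g != 0 by rewrite gcdp_eq0 negb_and b0 orbT.
have ag : a = a %/ g * g by rewrite divpK // dvdp_gcdl.
have bg : b = b %/ g * g by rewrite divpK // dvdp_gcdr.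
have b1 : b %/ g != 0 by apply: contraNneq b0 => E; rewrite bg E mul0r.
exists (a %/ g), (b %/ g); split=> //.
  by apply: coprimep_div_gcd; rewrite b0 orbT.
rewrite {1}ag {1}bg !tofracM -mulf_div divff ?mulr1 // tofrac_eq0 //.
Qed.

(** * Local rings of [K(X)] at irreducible polynomials *)

Definition local_at p x := exists a b, ~~ (p %| b) /\ x = a%:F / b%:F.

Lemma local_at_poly p a : irreducible_poly p -> local_at p a%:F.
Proof.
move=> [p1 _]; exists a, 1; rewrite tofrac1 divr1; split=> //.
by rewrite dvdp1 neq_ltn p1 orbT.
Qed.

Lemma ndvdp_neq0 p b : ~~ (p %| b) -> b != 0.
Proof. by apply: contraNneq => ->; apply: dvdp0. Qed.

Lemma ndvdpM p a b : irreducible_poly p ->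
  ~~ (p %| a) -> ~~ (p %| b) -> ~~ (p %| a * b).
Proof.
by move=> irr npa; apply: contraNN => H; apply: irreducible_prime H npa.
Qed.

Lemma valuation_ring_at p : irreducible_poly p -> valuation_ring (local_at p).
Proof.
move=> irr; split=> [|x y|x y|x].
- by rewrite -tofrac1; apply: local_at_poly.
- move=> [a [b [pb ->]]] [c [e [pe ->]]]; exists (a * e - c * b), (b * e).
  split; first exact: ndvdpM.
  rewrite subf_div ?tofrac_eq0 ?(ndvdp_neq0 pb) ?(ndvdp_neq0 pe) //.
  by rewrite tofracB !tofracM.
- move=> [a [b [pb ->]]] [c [e [pe ->]]]; exists (a * c), (b * e).
  by split; [apply: ndvdpM | rewrite !tofracM mulf_div].
have [a [b [b0 cab ->]]] := reduced_fraction x.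
case/boolP: (p %| b) => pb; [right | by left; exists a, b].
exists b, a; split; last by rewrite invfM invrK mulrC.
by apply: contraTN pb => pa; apply: coprime_ndvdp cab pa.
Qed.

Lemma local_at_derivation p (d : {poly K} -> {poly K}) (D : F -> F) x :
  irreducible_poly p -> is_derivation D -> (forall a, D a%:F = (d a)%:F) ->
  local_at p x -> local_at p (D x).
Proof.
move=> irr DP Dd [a [b [pb ->]]].
exists (d a * b - a * d b), (b ^+ 2); split; first by rewrite expr2; apply: ndvdpM.
rewrite (der_div DP) ?tofrac_eq0 ?(ndvdp_neq0 pb) //.
by rewrite !Dd tofracXn tofracB !tofracM.
Qed.

(** In lowest terms, a denominator of positive degree would have an irreducible factor, and [x]
    would have a pole there. *)
Lemma local_everywhere x : (forall p, irreducible_poly p -> local_at p x) ->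
  exists q, x = q%:F.
Proof.
have [a [b [b0 cab ->]]] := reduced_fraction x => H.
have [/irreducible_divisor [p irr pb]|b1] := ltnP 1 (size b).
  have [c [e [pe E]]] := H p irr; have e0 := ndvdp_neq0 pe.
  have {}E := frac_eq b0 e0 E.
  have pa : p %| a.
    by apply: (irreducible_prime (a := e)) => //; rewrite mulrC E dvdp_mull.
  by rewrite (negPf (coprime_ndvdp irr cab pa)) in pb.
have b1' : size b = 1%N by apply/eqP; rewrite eqn_leq b1 size_poly_gt0.
exists ((b`_0)^-1 *: a).
have bC : b = (b`_0)%:P by apply: size1_polyC; rewrite b1'.
have b00 : b`_0 != 0 by rewrite -polyC_eq0 -bC.
apply: (canLR (mulfK _)); first by rewrite tofrac_eq0.
by rewrite -tofracM {2}bC -scalerAl mulrC mul_polyC scalerA mulVf // scale1r.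
Qed.

(** * The local ring of [K(X)] at infinity *)

Definition local_at_oo x :=
  exists a b, [/\ b != 0, (size a <= size b)%N & x = a%:F / b%:F].

(* Restated at [{poly K}] so that [lia] sees a single instance of [size]. *)
Lemma size_mul_field a b : a != 0 -> b != 0 ->
  size (a * b) = (size a + size b).-1%N.
Proof. exact: size_mul. Qed.

Lemma size_mul_le a b (c e : {poly K}) : c != 0 -> e != 0 ->
  (size a <= size c)%N -> (size b <= size e)%N -> (size (a * b)%R <= size (c * e)%R)%N.
Proof.
move=> c0 e0 ac be; apply: (leq_trans (size_polyMleq _ _)).
rewrite size_mul_field //; move: c0 e0; rewrite -!size_poly_gt0; lia.
Qed.

Lemma size_sub_le a b n : (size a <= n)%N -> (size b <= n)%N -> (size (a - b)%R <= n)%N.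
Proof.
by move=> an bn; apply: (leq_trans (size_polyD _ _)); rewrite size_polyN geq_max an.
Qed.

Lemma valuation_ring_oo : valuation_ring local_at_oo.
Proof.
split=> [|x y|x y|x].
- by exists 1, 1; rewrite oner_neq0 tofrac1 divr1.
- move=> [a [b [b0 ab ->]]] [c [e [e0 ce ->]]]; exists (a * e - c * b), (b * e).
  split; [by rewrite mulf_neq0 | | ].
    by apply: size_sub_le; [|rewrite [b * e]mulrC]; apply: size_mul_le.
  by rewrite subf_div ?tofrac_eq0 // tofracB !tofracM.
- move=> [a [b [b0 ab ->]]] [c [e [e0 ce ->]]]; exists (a * c), (b * e).
  by rewrite mulf_neq0 ?size_mul_le // !tofracM mulf_div.
have [[a b] /= [b0 ->]] := fractionP x.
have [->|a0] := eqVneq a 0.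
  by left; exists 0, b; rewrite b0 size_poly0 tofrac0.
have [ab|ba] := leqP (size a) (size b); first by left; exists a, b.
by right; exists b, a; rewrite a0 (ltnW ba) invfM invrK mulrC.
Qed.

Lemma local_at_oo_const (c : K) : local_at_oo (c%:P)%:F.
Proof.
by exists c%:P, 1; rewrite oner_neq0 tofrac1 divr1 size_poly1 size_polyC leq_b1.
Qed.

(** In the quotient rule the numerator keeps its degree bound, because [d] does not raise
    degrees. *)
Lemma local_at_oo_coef_derivation (d : {poly K} -> {poly K}) (D : F -> F) x :
  (forall a, size (d a) <= size a)%N ->
  is_derivation D -> (forall a, D a%:F = (d a)%:F) ->
  local_at_oo x -> local_at_oo (D x).
Proof.
move=> sd DP Dd [a [b [b0 ab ->]]].
exists (d a * b - a * d b), (b ^+ 2); split; first by rewrite expf_neq0.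
  by apply: size_sub_le; apply: size_mul_le => //; apply: leq_trans (sd _) _.
by rewrite (der_div DP) ?tofrac_eq0 // !Dd tofracXn tofracB !tofracM.
Qed.

(* With [t = 1/X] one has [- X^2 d/dX = d/dt], which preserves the local ring
   at [t = 0]. *)
Lemma local_at_oo_deriv (D : F -> F) x :
  is_derivation D -> (forall a, D a%:F = (a^`())%:F) ->
  local_at_oo x -> local_at_oo ('X^2%:F * D x).
Proof.
move=> DP Dd [a [b [b0 ab ->]]].
have bF : b%:F != 0 by rewrite tofrac_eq0.
(* [c] is the value of [x] at infinity. [D] kills this constant, and subtracting it makes the degree
   inequality strict, which compensates for the factor ['X^2]. *)
pose c := a`_(size b).-1 / lead_coef b; pose a1 := a - c *: b.
have sb0 : (0 < size b)%N by rewrite size_poly_gt0.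
have a1b : (size a1 < size b)%N.
  rewrite -(prednK sb0) ltnS; apply/leq_sizeP => j.
  rewrite leq_eqVlt => /orP[/eqP<-|jb].
    by rewrite coefB coefZ /c lead_coefE divfK ?subrr // -lead_coefE lead_coef_eq0.
  have bj : (size b <= j)%N by rewrite -(prednK sb0).
  by rewrite coefB coefZ !nth_default ?mulr0 ?subrr // (leq_trans ab).
have -> : a%:F / b%:F = (c%:P)%:F + a1%:F / b%:F.
  rewrite /a1 tofracB -mul_polyC tofracM mulrBl mulfK //.
  by rewrite addrC subrK.
clearbody a1; rewrite (derD DP) Dd derivC tofrac0 add0r (der_div DP) // !Dd.
exists ('X^2 * (a1^`() * b - a1 * b^`())), (b ^+ 2).
split; first by rewrite expf_neq0.
  have [->|a10] := eqVneq a1 0.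
    by rewrite linear0 !mul0r subr0 mulr0 size_poly0.
  have sb := lt_size_deriv b0; have sa := lt_size_deriv a10.
  apply: (leq_trans (size_polyMleq _ _)); rewrite size_polyXn.
  have -> : size (b ^+ 2) = (size b + size b).-1%N by rewrite expr2 size_mul_field.
  have : (size (a1^`() * b - a1 * b^`())%R <= (size b + size b).-2.-1)%N.
    apply: size_sub_le; apply: (leq_trans (size_polyMleq _ _)); lia.
  lia.
rewrite (tofracXn 2 b) [('X^2 * _)%:F]tofracM tofracB [(a1^`() * b)%:F]tofracM.
by rewrite [(a1 * _)%:F]tofracM mulrA.
Qed.

Lemma poly_local_at_oo q : local_at_oo ('X^2%:F * q%:F) -> q = 0.
Proof.
move=> [a [b [b0 ab E]]]; apply: contraTeq ab => q0; rewrite -ltnNge.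
have {E} : ('X^2 * q)%:F / 1%:F = a%:F / b%:F by rewrite tofracM tofrac1 divr1.
move/(frac_eq (oner_neq0 _) b0); rewrite mulr1 => <-.
have X0 : 'X^2 != 0 :> {poly K} by rewrite expf_neq0 // polyX_eq0.
rewrite (size_mul_field (mulf_neq0 X0 q0) b0) (size_mul_field X0 q0).
rewrite size_polyXn.
move: b0 q0; rewrite -!size_poly_gt0; lia.
Qed.

(** Both derivations preserve the local rings at finite places, so the quotient is a polynomial [q].
    At infinity [D1] has to be replaced by ['X^2 * D1], so it is ['X^2 * q] that is regular there,
    which forces [q = 0]. *)
Theorem regular_form_eq0 (dK : {poly K} -> {poly K}) (D1 D2 : F -> F) x y r :
    (forall n, n.+1%:R != 0 :> K) ->
    (forall a, size (dK a) <= size a)%N ->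
    is_derivation D1 -> (forall a, D1 a%:F = (a^`())%:F) ->
    is_derivation D2 -> (forall a, D2 a%:F = (dK a)%:F) ->
    r ^+ 2 = radicand_at x y ->
  jacobian D1 D2 x y / r = 0.
Proof.
move=> char0 sdK D1P D1E D2P D2E E.
have natE n : n%:R = (n%:R%:P)%:F :> F by rewrite !rmorph_nat.
have charF n : n.+1%:R != 0 :> F.
  by rewrite natE tofrac_eq0 polyC_eq0.
have natV n : n.+1%:R^-1 = ((n.+1%:R^-1)%:P)%:F :> F.
  apply: (mulIf (charF n)); rewrite mulVf // natE -tofracM -polyCM mulVf //.
have [p irr|q qE] := @local_everywhere (jacobian D1 D2 x y / r).
  apply: two_form_regular E => // [|n|z|z].
  - exact: valuation_ring_at.
  - by rewrite natV; apply: local_at_poly.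
  - exact: local_at_derivation.
  - exact: local_at_derivation.
rewrite qE (@poly_local_at_oo q) ?tofrac0 // -qE.
have -> : 'X^2%:F * (jacobian D1 D2 x y / r)
    = jacobian (fun z => 'X^2%:F * D1 z) D2 x y / r.
  by rewrite jacobian_scale mulrA.
apply: two_form_regular E => // [|n||z|z].
- exact: valuation_ring_oo.
- by rewrite natV; apply: local_at_oo_const.
- exact: derivation_scale.
- exact: local_at_oo_deriv.
- exact: local_at_oo_coef_derivation.
Qed.

End RationalFunctions.

(** * The Jacobian criterion *)

(** A matrix with more rows than columns has a non-zero left kernel. Arbitrary finite index types
    allow families indexed by triples with coordinates indexed by pairs. *)
Lemma linear_dependence (K : fieldType) (I J : finType) (v : I -> J -> K) :
  (#|J| < #|I|)%N ->
  exists2 c : I -> K, (exists i, c i != 0) & forall j, \sum_i c i * v i j = 0.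
Proof.
move=> JI; pose M := \matrix_(i < #|I|, j < #|J|) v (enum_val i) (enum_val j).
have : kermx M != 0.
  rewrite -mxrank_eq0 mxrank_ker subn_eq0 -ltnNge.
  exact: leq_ltn_trans (rank_leq_col M) JI.
case/rowV0Pn => u /sub_kermxP uM u0.
exists (fun i => u 0 (enum_rank i)).
  apply: contrapT => nex; case/negP: u0; apply/eqP/rowP => i; rewrite mxE.
  apply/eqP/negPn/negP => ui; apply: nex; exists (enum_val i).
  by rewrite enum_valK.
move=> j; have /rowP/(_ (enum_rank j)) := uM; rewrite !mxE => H; rewrite -[RHS]H.
rewrite (reindex_onto (@enum_val I I) enum_rank) => [|i _]; last exact: enum_rankK.
apply: eq_big => [i|i _]; first by rewrite enum_valK eqxx.
by rewrite mxE enum_valK enum_rankK.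
Qed.

Section BivariatePolynomials.
Variable C : fieldType.
Implicit Types p q : {poly {poly C}}.

Definition bidegree_le m p :=
  (size p <= m.+1)%N /\ forall i, (size (p`_i)%R <= m.+1)%N.

Lemma bidegree_le_exists p : exists m, bidegree_le m p.
Proof.
exists (size p + \max_(i < size p) size (p`_i)%R)%N; split=> [|i].
  by rewrite ltnW // ltnS leq_addr.
have [ip|pi] := ltnP i (size p); last by rewrite nth_default ?size_poly0.
have := leq_bigmax (F := fun i : 'I_(size p) => size (p`_i)%R) (Ordinal ip).
by rewrite /= => H; apply: leq_trans H _; lia.
Qed.

Lemma bidegree_leW m n p : (m <= n)%N -> bidegree_le m p -> bidegree_le n p.
Proof. by move=> mn [sp cp]; split=> [|i]; apply: leq_trans (cp i) _ || apply: leq_trans sp _. Qed.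

Lemma bidegree_leM m n p q :
  bidegree_le m p -> bidegree_le n q -> bidegree_le (m + n) (p * q).
Proof.
move=> [sp cp] [sq cq]; split=> [|i].
  by apply: leq_trans (size_polyMleq _ _) _; lia.
rewrite coefM; apply: leq_trans (size_sum _ _ _) _; apply/bigmax_leqP => j _.
apply: leq_trans (size_polyMleq _ _) _.
have := cp j; have := cq (i - j)%N; lia.
Qed.

Lemma bidegree_leX m n p : bidegree_le m p -> bidegree_le (n * m) (p ^+ n).
Proof.
move=> bp; elim: n => [|n IH]; last by rewrite exprS mulSn; apply: bidegree_leM.
rewrite expr0; split=> [|i]; first by rewrite size_poly1.
by rewrite coef1; case: (i == 0)%N; rewrite ?size_poly1 ?size_poly0.
Qed.

(* The [n^3] products below have bidegree at most [3 n m], so they live in a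
   space of dimension [(3 n m + 1)^2 < n^3] for [n] large. *)
Lemma homogeneous_dependence (z a b d : {poly {poly C}}) :
  exists n (c : 'I_n * 'I_n * 'I_n -> C), (exists i, c i != 0) /\
    \sum_i (c i)%:P%:P * (z ^+ i.1.1 * (a ^+ i.1.2 * b ^+ i.2
      * d ^+ (2 * n - i.1.2 - i.2))) = 0.
Proof.
have [mz bz] := bidegree_le_exists z; have [ma ba] := bidegree_le_exists a.
have [mb bb] := bidegree_le_exists b; have [md bd] := bidegree_le_exists d.
(* Since [3 n m + 1 <= (3 m + 1) n], any [n > (3 m + 1)^2] satisfies [(3 n m + 1)^2 < n^3]. *)
pose m := (mz + ma + mb + md)%N; pose n := ((3 * m + 1) ^ 2).+1.
have {}bz : bidegree_le m z by apply: bidegree_leW bz; lia.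
have {}ba : bidegree_le m a by apply: bidegree_leW ba; lia.
have {}bb : bidegree_le m b by apply: bidegree_leW bb; lia.
have {}bd : bidegree_le m d by apply: bidegree_leW bd; lia.
pose v (i : 'I_n * 'I_n * 'I_n) := z ^+ i.1.1 * (a ^+ i.1.2 * b ^+ i.2
  * d ^+ (2 * n - i.1.2 - i.2)).
pose B := (3 * n * m).+1.
have bv i : bidegree_le (3 * n * m) (v i).
  case: i => [[i j] k]; rewrite /v /=.
  have ji := ltn_ord j; have ki := ltn_ord k; have ii := ltn_ord i.
  apply: (@bidegree_leW (i * m + (j * m + k * m + (2 * n - j - k) * m))).
    rewrite -!mulnDl leq_mul2r; apply/orP; right; lia.
  by do ?apply: bidegree_leM; apply: bidegree_leX.
have [|c c0 cv] := @linear_dependence C ('I_n * 'I_n * 'I_n)%type ('I_B * 'I_B)%type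
    (fun i j => (v i)`_j.1`_j.2).
  rewrite !card_prod !card_ord /B.
  have Hn : n = ((3 * m + 1) ^ 2).+1 by [].
  clearbody n. nia.
exists n, c; split=> //; apply/polyP => i; apply/polyP => j.
have vE k : ((c k)%:P%:P * v k)`_i`_j = c k * (v k)`_i`_j.
  by rewrite coefCM coefCM.
rewrite !coef0 coef_sum coef_sum (eq_bigr _ (fun k _ => vE k)).
have [iB|Bi] := ltnP i B; last first.
  apply: big1 => k _; have [sv _] := bv k.
  by rewrite [(v k)`_i]nth_default ?coef0 ?mulr0 // (leq_trans sv).
have [jB|Bj] := ltnP j B; last first.
  apply: big1 => k _; have [_ /(_ i) sv] := bv k.
  by rewrite [_`_j]nth_default ?mulr0 // (leq_trans sv).
exact: (cv (Ordinal iB, Ordinal jB)).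
Qed.

End BivariatePolynomials.

Section ConstantsOfADerivation.
Variables (F : fieldType) (d : F -> F).
Hypothesis dP : is_derivation d.
Hypothesis char0 : forall n, n.+1%:R != 0 :> F.

Lemma derivation_horner (p : {poly F}) z : (forall i, d p`_i = 0) ->
  d p.[z] = p^`().[z] * d z.
Proof.
elim/poly_ind: p => [|p c IH] dp0.
  by rewrite linear0 !horner0 mul0r (der0 dP).
have c0 : d c = 0.
  by have := dp0 0%N; rewrite coefD coefMX coefC /= add0r.
have {}IH : d p.[z] = p^`().[z] * d z.
  by apply: IH => i; have := dp0 i.+1; rewrite coefD coefMX coefC /= addr0.
rewrite derivD derivC addr0 derivM derivX mulr1 !hornerE (derD dP) (derM dP) c0 IH.
ring.
Qed.

(** Applying [d] to [p(z) = 0] gives [p'(z) * d z = 0], so [p'] is a shorter relation and vanishes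
    by induction; in characteristic 0 this makes [p] constant. *)
Lemma nonconstant_transcendental (p : {poly F}) z : d z != 0 ->
  (forall i, d p`_i = 0) -> p.[z] = 0 -> p = 0.
Proof.
move=> dz; move: {2}(size p) (leqnn (size p)) => n.
elim: n p => [|n IH] p; first by rewrite leqn0 size_poly_eq0 => /eqP.
move=> pn dp0 pz.
have dp : p^`() = 0.
  have [->|p0] := eqVneq p 0; first by rewrite linear0.
  apply: IH.
  - by rewrite -ltnS (leq_trans (lt_size_deriv p0)).
  - move=> i; rewrite coef_deriv -mulr_natr (derM dP) dp0 (der_natr dP).
    by rewrite mul0r mulr0 addr0.
  - have := derivation_horner z dp0; rewrite pz (der0 dP) => /esym/eqP.
    by rewrite mulf_eq0 (negPf dz) orbF => /eqP.
have pC : p = (p`_0)%:P.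
  apply/polyP => -[|i]; rewrite coefC //=.
  have /polyP/(_ i)/eqP := dp; rewrite coef_deriv coef0 -mulr_natr mulf_eq0.
  by rewrite (negPf (char0 i)) orbF => /eqP.
by move: pz; rewrite pC hornerC => ->.
Qed.

Variable C : fieldType.
Variable e : {rmorphism {poly {poly C}} -> F}.
Hypothesis e_inj : injective e.
Hypothesis de : forall c, d (e c%:P%:P) = 0.

Definition algebraically_independent (x y : F) :=
  forall n (c : 'I_n -> 'I_n -> C),
    \sum_i \sum_j e (c i j)%:P%:P * (x ^+ i * y ^+ j) = 0 ->
    forall i j, c i j = 0.

Lemma derivation_exp x n : d x = 0 -> d (x ^+ n) = 0.
Proof.
move=> dx; elim: n => [|n IH]; first by rewrite (der1 dP).
by rewrite exprS (derM dP) dx IH mul0r mulr0 addr0.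
Qed.

(** [homogeneous_dependence] makes [e z] algebraic over the field generated by [C], [x] and [y], all
    killed by [d]. Were [d (e z)] non-zero, [e z] would be transcendental over the constants of [d];
    the coefficients [r i] of the relation would vanish, against the independence of [x] and [y]. *)
Lemma derivation_eq0 a b q z :
    q != 0 -> algebraically_independent (e a / e q) (e b / e q) ->
    d (e a / e q) = 0 -> d (e b / e q) = 0 ->
  d (e z) = 0.
Proof.
move=> q0 indep; set x := e a / e q; set y := e b / e q => dx dy.
have eq0 : e q != 0 by rewrite -(rmorph0 e) (inj_eq e_inj).
apply/eqP/negPn/negP => dz.
have [n [c [[k ck] E]]] := homogeneous_dependence z a b q.
pose r i := \sum_(j < n) \sum_(l < n) e (c (i, j, l))%:P%:P * (x ^+ j * y ^+ l).
pose p := \sum_(i < n) (r i)%:P * 'X^i.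
have pE i : p`_i = if insub i is Some i' then r i' else 0.
  rewrite /p coef_sum; under eq_bigr do rewrite coefCM coefXn.
  case: insubP => [i' _ i'E|ni]; last first.
    rewrite big1 // => j _; case: eqP => [ij|_]; last by rewrite mulr0.
    by rewrite ij ltn_ord in ni.
  rewrite (bigD1 i') //= -i'E eqxx mulr1 big1 ?addr0 // => j ji.
  by case: eqP => [/val_inj ij|_]; [rewrite ij eqxx in ji | rewrite mulr0].
have dp i : d p`_i = 0.
  rewrite pE; case: insubP => [i' _ _|_]; last exact: (der0 dP).
  rewrite /r (der_sum dP) big1 // => j _; rewrite (der_sum dP) big1 // => l _.
  by rewrite !(derM dP) de !derivation_exp // !(mul0r, mulr0, addr0).
have pz : p.[e z] = 0.
  pose G i j l := e (c (i, j, l))%:P%:P * (x ^+ j * y ^+ l) * e z ^+ i.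
  have -> : p.[e z] = \sum_k G k.1.1 k.1.2 k.2.
    rewrite -(pair_bigA _ (fun ij l => G ij.1 ij.2 l)) /=.
    rewrite -(pair_bigA _ (fun i j => \sum_l G i j l)) /= horner_sum.
    apply: eq_bigr => i _; rewrite hornerCM hornerXn /r mulr_suml.
    by apply: eq_bigr => j _; rewrite mulr_suml.
  (* Multiplication by the power [2 * n] of the common denominator recovers the homogeneous relation
     [E]. *)
  apply: (mulIf (expf_neq0 (2 * n) eq0)); rewrite mul0r mulr_suml.
  have /(congr1 e) := E; rewrite rmorph0 => E'; rewrite -[RHS]E'.
  rewrite rmorph_sum; apply: eq_bigr => -[[i j] l] _.
  rewrite /G /x /y /= !rmorphM !rmorphXn !expr_div_n.
  have -> : e q ^+ (2 * n) = e q ^+ j * (e q ^+ l * e q ^+ (2 * n - j - l)).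
    rewrite -!exprD; congr (_ ^+ _).
    have := ltn_ord j; have := ltn_ord l; lia.
  have := expf_neq0 j eq0; have := expf_neq0 l eq0.
  move: (e q ^+ j) (e q ^+ l) (e q ^+ _) => u v w v0 u0.
  by field; rewrite ?u0 ?v0.
have p_0 := nonconstant_transcendental dz dp pz.
case: k ck => -[i j] l; rewrite (indep n (fun j l => c (i, j, l))) ?eqxx //.
by have := pE i; rewrite p_0 coef0 valK => /esym.
Qed.

End ConstantsOfADerivation.

Lemma derivation_jacobian (F : fieldType) (d1 d2 : F -> F) w :
  is_derivation d1 -> is_derivation d2 -> is_derivation (jacobian d1 d2 w).
Proof.
move=> d1P d2P; split=> x y; rewrite /jacobian.
  by rewrite (derD d1P) (derD d2P); ring.
by rewrite (derM d1P) (derM d2P); ring.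
Qed.

(* If the Jacobian vanishes, then so do the derivations [J(y, _)] and [J(x, _)],
   as they kill [x] and [y]; hence [d1] kills [x] and [y] as well, so [d1 = 0]. *)
Lemma jacobian_neq0 (F C : fieldType) (d1 d2 : F -> F)
    (e : {rmorphism {poly {poly C}} -> F}) a b q :
    (forall n, n.+1%:R != 0 :> F) -> injective e ->
    is_derivation d1 -> is_derivation d2 ->
    (forall c, d1 (e c%:P%:P) = 0) -> (forall c, d2 (e c%:P%:P) = 0) ->
    d1 (e 'X) = 1 -> d1 (e 'X%:P) = 0 -> d2 (e 'X) = 0 -> d2 (e 'X%:P) = 1 ->
    q != 0 -> algebraically_independent e (e a / e q) (e b / e q) ->
  jacobian d1 d2 (e a / e q) (e b / e q) != 0.
Proof.
move=> char0 e_inj d1P d2P d1c d2c d1s d1t d2s d2t q0 indep; apply/eqP => J0.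
have Jxx x : jacobian d1 d2 x x = 0 by rewrite /jacobian; ring.
have Jc w c : jacobian d1 d2 w (e c%:P%:P) = 0.
  by rewrite /jacobian d1c d2c; ring.
(* The derivation [J(w, _)] kills the whole image of [e]; its values at ['X%:P] and ['X] are [d1 w]
   and [- d2 w]. *)
have D0 w : jacobian d1 d2 w (e a / e q) = 0 ->
    jacobian d1 d2 w (e b / e q) = 0 -> d1 w = 0 /\ d2 w = 0.
  move=> wx wy; have wP := derivation_jacobian w d1P d2P.
  have E z := derivation_eq0 wP char0 e_inj (Jc w) z q0 indep wx wy.
  split; first by have := E 'X%:P; rewrite /jacobian d1t d2t mulr1 mulr0 subr0.
  have := E 'X; rewrite /jacobian d1s d2s mulr1 mulr0 sub0r => /eqP.
  by rewrite oppr_eq0 => /eqP.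
have [x1 _] := D0 _ (Jxx _) J0.
have J0' : jacobian d1 d2 (e b / e q) (e a / e q) = 0.
  by rewrite -[RHS]oppr0 -[in RHS]J0 /jacobian; ring.
have [y1 _] := D0 _ J0' (Jxx _).
have := derivation_eq0 d1P char0 e_inj d1c 'X q0 indep x1 y1.
by rewrite d1s => /eqP; rewrite oner_eq0.
Qed.

(** * Bivariate polynomials and dominance *)

Lemma poly_vanish_eq0 (C : fieldType) (p : {poly C}) :
  (forall n, n.+1%:R != 0 :> C) -> (forall x, p.[x] = 0) -> p = 0.
Proof.
move=> char0 p0; apply/eqP/negPn/negP => pn0.
have nat_inj : injective (fun n => n%:R : C).
  have lt_neq i j : (i < j)%N -> (i%:R : C) != j%:R.
    move=> ij; rewrite eq_sym -subr_eq0 -natrB ?(ltnW ij) //.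
    by case E : (j - i)%N => [|n]; [lia | apply: char0].
  move=> i j; case: (ltngtP i j) => // /lt_neq/eqP nij H; first by case: nij.
  by case: nij.
have := @max_poly_roots _ p [seq i%:R | i <- iota 0 (size p)] pn0.
rewrite size_map size_iota ltnn => H; suff: false by []; apply: H.
  by apply/allP => x _; rewrite rootE p0.
by rewrite map_inj_uniq ?iota_uniq.
Qed.

Section Bivariate.
Variable C : fieldType.
Local Notation P := {poly {poly C}}.

Definition const2 : C -> P := polyC \o polyC.
HB.instance Definition _ := GRing.RMorphism.on const2.

(** [s] becomes the outer variable and [t] the inner one, in accordance with the iterated field
    [C(t)(s)]. *)
Definition poly_of_mpoly : {mpoly C[2]} -> P :=
  mmap const2 (pair_fun 'X 'X%:P).
HB.instance Definition _ := GRing.RMorphism.on poly_of_mpoly.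

Lemma mmap1_pair (S : comNzRingType) (a b : S) m :
  mmap1 (pair_fun a b) m = a ^+ m ord0 * b ^+ m (lift ord0 ord0).
Proof. by rewrite /mmap1 big_ord_recl big_ord1. Qed.

Lemma monomial2_coef i j k l :
  ('X^i * 'X%:P ^+ j : P)`_k`_l = if (k == i) && (l == j) then 1 else 0.
Proof.
rewrite -rmorphXn /= mulrC coefCM coefXn.
case: (k == i); rewrite ?mulr1 ?mulr0 ?coef0 //= coefXn.
by case: (l == j).
Qed.

Lemma poly_of_mpoly_inj : injective poly_of_mpoly.
Proof.
apply: raddf_inj => p p0; apply/mpolyP => m; rewrite mcoeff0.
have := congr1 (fun q : P => q`_(m ord0)`_(m (lift ord0 ord0))) p0.
rewrite !coef0 /poly_of_mpoly /mmap coef_sum coef_sum => E; rewrite -[RHS]E {E}.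
under eq_bigr => k _.
  rewrite mmap1_pair coefCM coefCM monomial2_coef. over.
rewrite /=; have [mp|mp] := boolP (m \in msupp p); last first.
  rewrite (memN_msupp_eq0 mp); apply/esym/big1_seq => k /andP[_ kp].
  case: ifP => [/andP[/eqP m0 /eqP m1]|_]; last by rewrite mulr0.
  case/negP: mp; suff -> : m = k by [].
  by apply/mnmP => i; case: (unliftP ord0 i) => [j|] ->; rewrite ?(ord1 j).
rewrite (bigD1_seq m) ?msupp_uniq //= !eqxx mulr1 big1 ?addr0 // => k km.
case: ifP => [/andP[/eqP m0 /eqP m1]|_]; last by rewrite mulr0.
case/eqP: km; apply/mnmP => i.
by case: (unliftP ord0 i) => [j|] ->; rewrite ?(ord1 j).
Qed.

(** The numerator [h] is chosen before the morphism, so that the same [h] can be read both in the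
    function field and at a point where the denominators do not vanish. *)
Lemma clear_denominators (p n1 d1 n2 d2 : {mpoly C[2]}) :
  exists h, forall (L : fieldType) (f : {rmorphism {mpoly C[2]} -> L}),
    f d1 != 0 -> f d2 != 0 ->
    f h = f (d1 * d2) ^+ msize p *
      mmap (fun c => f c%:MP) (pair_fun (f n1 / f d1) (f n2 / f d2)) p.
Proof.
set N := msize p; pose i0 : 'I_2 := ord0; pose i1 : 'I_2 := lift ord0 ord0.
exists (\sum_(m <- msupp p) (p@_m)%:MP
  * (n1 ^+ m i0 * d1 ^+ (N - m i0) * (n2 ^+ m i1 * d2 ^+ (N - m i1)))).
move=> L f d10 d20; rewrite rmorph_sum /mmap mulr_sumr big_seq [RHS]big_seq.
apply: eq_bigr => m /msize_mdeg_lt mN.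
have le i : (m i <= N)%N.
  by rewrite (leq_trans _ (ltnW mN)) // mdegE (bigD1 i) //= leq_addr.
have split_exp d i : f d ^+ N = f d ^+ m i * f d ^+ (N - m i).
  by rewrite -exprD subnKC.
rewrite mmap1_pair !rmorphM !rmorphXn !expr_div_n exprMn.
rewrite (split_exp d1 i0) (split_exp d2 i1).
have := expf_neq0 (m i0) d10; have := expf_neq0 (m i1) d20.
rewrite -/i0 -/i1; move: (f d1 ^+ _) (f d2 ^+ _) => u v.
move: (f d2 ^+ m i1) (f d1 ^+ m i0) (f n1 ^+ _) (f n2 ^+ _) (f _%:MP).
by move=> x y z w c x0 y0; field; rewrite ?x0 ?y0.
Qed.

(** The numerator of [p(phi, psi)] is the zero polynomial, so [p] vanishes at each point of the
    image; dominance extends this to the plane. *)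
Lemma dominant_vanish (phi psi : ratfun2 C) (p : {mpoly C[2]}) :
  dominant phi psi -> mpoly_subst p phi psi = 0 ->
  forall a b, p.@[pair_fun a b] = 0.
Proof.
move=> dom p0 a b; apply: (dom (a, b)) => -[a' b'] /=.
move=> [[u v] /= [[n1 [d1 [d10 phiE ->]]] [n2 [d2 [d20 psiE ->]]]]].
have [h hE] := clear_denominators p n1 d1 n2 d2.
have d_neq0 d : d.@[pair_fun u v] != 0 -> d != 0.
  by apply: contraNneq => ->; rewrite meval0.
have h0 : h = 0.
  apply/eqP; rewrite -tofrac_eq0 hE ?tofrac_eq0 ?d_neq0 //.
  by rewrite -phiE -psiE -[mmap _ _ _]/(mpoly_subst p phi psi) p0 mulr0.
have := hE _ (meval (pair_fun u v)) d10 d20; rewrite h0 rmorph0 => /esym/eqP.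
rewrite mulf_eq0 expf_eq0 rmorphM mulf_eq0 (negPf d10) (negPf d20) andbF /=.
move/eqP; apply: etrans; rewrite /meval /mmap; apply: eq_bigr => m _.
by congr (_ * _); apply/esym/mevalC.
Qed.

End Bivariate.

(** * Non-existence of a rational parametrisation *)

Lemma rmorph_radicand (R S : comPzRingType) (f : {rmorphism R -> S}) x y :
  f (radicand_at x y) = radicand_at (f x) (f y).
Proof.
by rewrite /radicand_at !(rmorphD, rmorphM, rmorphN, rmorphXn, rmorph1, rmorph_nat).
Qed.

Lemma derivation_deriv (R : comNzRingType) : is_derivation (@deriv R).
Proof. by split=> p q; [rewrite derivD | rewrite derivM]. Qed.

Lemma derivation_map_poly (K : comNzRingType) (d : K -> K) :
  is_derivation d -> is_derivation (map_poly d).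
Proof.
move=> dP; have d0 := der0 dP.
split=> p q; apply/polyP => i; first by rewrite !(coefD, coef_map_id0) // (derD dP).
rewrite coefD coef_map_id0 // !coefM (der_sum dP) -big_split /=.
by apply: eq_bigr => j _; rewrite (derM dP) !coef_map_id0.
Qed.

Lemma derivation_map_polyC (K : comNzRingType) (d : K -> K) c :
  is_derivation d -> map_poly d c%:P = (d c)%:P.
Proof.
move=> dP; apply/polyP => i; rewrite coef_map_id0 ?(der0 dP) // !coefC.
by case: eqP => // _; rewrite (der0 dP).
Qed.

Lemma derivation_map_polyX (K : comNzRingType) (d : K -> K) :
  is_derivation d -> map_poly d 'X = 0.
Proof.
move=> dP; apply/polyP => i; rewrite coef_map_id0 ?(der0 dP) // coefX coef0.
exact: der_natr.
Qed.

Section Substitution.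
Variable C : fieldType.
Implicit Types phi psi : ratfun2 C.

Lemma mpoly_substE phi psi (p : {mpoly C[2]}) :
  mpoly_subst p phi psi
  = mmap ((@FracField.tofrac _ : {rmorphism {mpoly C[2]} -> _}) \o (@mpolyC 2 C))
      (pair_fun phi psi) p.
Proof. by []. Qed.

Lemma mpoly_subst_radicand phi psi :
  mpoly_subst (radicand_at 'X_0 'X_1) phi psi = radicand_at phi psi.
Proof.
rewrite mpoly_substE rmorph_radicand; congr radicand_at.
  by rewrite /= mmapX mmap1U.
by rewrite /= mmapX mmap1U.
Qed.

Lemma mpoly_subst_sum phi psi n (c : 'I_n -> 'I_n -> C) :
  mpoly_subst (\sum_i \sum_j (c i j)%:MP * ('X_0 ^+ i * 'X_1 ^+ j)) phi psi
  = \sum_i \sum_j (@FracField.tofrac {mpoly C[2]} (c i j)%:MP) * (phi ^+ i * psi ^+ j).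
Proof.
rewrite mpoly_substE rmorph_sum; apply: eq_bigr => i _.
rewrite rmorph_sum; apply: eq_bigr => j _.
rewrite !rmorphM !rmorphXn; congr (_ * (_ ^+ _ * _ ^+ _)).
- by rewrite /= mmapC.
- by rewrite /= mmapX mmap1U.
- by rewrite /= mmapX mmap1U.
Qed.

(** By dominance the relation holds at every point of the plane, and its coefficients are then
    eliminated one variable at a time. *)
Lemma dominant_independent phi psi n (c : 'I_n -> 'I_n -> C) :
  (forall n, n.+1%:R != 0 :> C) -> dominant phi psi ->
  \sum_i \sum_j (@FracField.tofrac {mpoly C[2]} (c i j)%:MP) * (phi ^+ i * psi ^+ j) = 0 ->
  forall i j, c i j = 0.
Proof.
move=> char0 dom E.
have H a b : \sum_i \sum_j c i j * (a ^+ i * b ^+ j) = 0.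
  have := dominant_vanish dom (etrans (mpoly_subst_sum _ _ _) E) a b.
  move=> H; rewrite -[RHS]H rmorph_sum; apply: eq_bigr => i _.
  rewrite rmorph_sum; apply: eq_bigr => j _.
  rewrite !rmorphM !rmorphXn /= mevalC !mevalXU //.
have Hb b i : \sum_j c i j * b ^+ j = 0.
  pose p := \poly_(i < n) (if insub i is Some i' then \sum_j c i' j * b ^+ j else 0).
  have p0 : p = 0.
    apply: poly_vanish_eq0 => // a; rewrite horner_poly -[RHS](H a b).
    apply: eq_bigr => k _; rewrite valK mulr_suml; apply: eq_bigr => j _.
    by rewrite -mulrA [a ^+ _ * _]mulrC.
  have /polyP/(_ i) := p0; rewrite coef_poly coef0 ltn_ord valK //.
move=> i j.
pose p := \poly_(j < n) (if insub j is Some j' then c i j' else 0).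
have p0 : p = 0.
  apply: poly_vanish_eq0 => // b; rewrite horner_poly -[RHS](Hb b i).
  by apply: eq_bigr => k _; rewrite valK.
by have /polyP/(_ j) := p0; rewrite coef_poly coef0 ltn_ord valK.
Qed.

End Substitution.

Section NoParametrisation.
Variable C : fieldType.
Hypothesis char0 : forall n, n.+1%:R != 0 :> C.
Local Notation K := {fraction {poly C}}.
Local Notation F := {fraction {poly K}}.

Definition bipoly_frac : {poly {poly C}} -> F :=
  @FracField.tofrac {poly K} \o map_poly (@FracField.tofrac {poly C}).
HB.instance Definition _ := GRing.RMorphism.on bipoly_frac.

Lemma bipoly_frac_inj : injective bipoly_frac.
Proof.
apply: inj_comp; first by move=> x y /eqP; rewrite tofrac_eq => /eqP.
by apply: map_inj_poly; [move=> x y /eqP; rewrite tofrac_eq => /eqP | rewrite tofrac0].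
Qed.

Lemma bipoly_fracX : bipoly_frac 'X = @FracField.tofrac {poly K} 'X.
Proof. by rewrite /bipoly_frac /= map_polyX. Qed.

Lemma bipoly_fracC p :
  bipoly_frac p%:P = @FracField.tofrac {poly K} (@FracField.tofrac {poly C} p)%:P.
Proof. by rewrite /bipoly_frac /= map_polyC. Qed.

Theorem no_parametrisation (phi psi r : ratfun2 C) :
  dominant phi psi -> r ^+ 2 <> radicand_at phi psi.
Proof.
move=> dom E.
(* [dK] is [d/dt] on [C(t)], [D1] is [d/ds] on [C(t)(s)], and [D2] is [d/dt] there, obtained by
   letting [dK] act on the coefficients. *)
have [dK dKP dKE] := frac_derivation (derivation_deriv C).
have [D1 D1P D1E] := frac_derivation (derivation_deriv K).
have mdKP := derivation_map_poly dKP.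
have [D2 D2P D2E] := frac_derivation mdKP.
have e_inj := bipoly_frac_inj.
have [g gE] := frac_rmorphism (f := bipoly_frac \o @poly_of_mpoly C)
  (inj_comp e_inj (@poly_of_mpoly_inj C)).
have charK n : n.+1%:R != 0 :> K.
  by rewrite -(rmorph_nat (@FracField.tofrac {poly C})) tofrac_eq0 -polyC_natr polyC_eq0.
have charF n : n.+1%:R != 0 :> F.
  by rewrite -(rmorph_nat (@FracField.tofrac {poly K})) tofrac_eq0 -polyC_natr polyC_eq0.
have [[n1 m1] /= [m10 phiE]] := fractionP phi.
have [[n2 m2] /= [m20 psiE]] := fractionP psi.
pose a := poly_of_mpoly (n1 * m2); pose b := poly_of_mpoly (n2 * m1).
pose q := poly_of_mpoly (m1 * m2).
have mu0 m : m != 0 -> poly_of_mpoly m != 0 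
  by rewrite raddf_eq0 //; apply: poly_of_mpoly_inj.
have e0 m : m != 0 -> bipoly_frac m != 0 by rewrite raddf_eq0.
have q0 : q != 0 by rewrite mu0 // mulf_neq0.
have xE : g phi = bipoly_frac a / bipoly_frac q.
  rewrite phiE fmorph_div !gE /a /q /= !rmorphM -mulf_div divff ?mulr1 //.
  by rewrite e0 ?mu0.
have yE : g psi = bipoly_frac b / bipoly_frac q.
  rewrite psiE fmorph_div !gE /b /q /= !rmorphM /= [X in _ = _ / X]mulrC.
  by rewrite -mulf_div divff ?mulr1 // e0 ?mu0.
have indep : algebraically_independent bipoly_frac (g phi) (g psi).
  move=> n c H; apply: (dominant_independent char0 dom).
  apply: (fmorph_inj g); rewrite rmorph0 -[RHS]H rmorph_sum.
  apply: eq_bigr => i _; rewrite rmorph_sum; apply: eq_bigr => j _.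
  by rewrite !rmorphM !rmorphXn gE /= /poly_of_mpoly mmapC.
have J0 : jacobian D1 D2 (g phi) (g psi) != 0.
  rewrite xE yE; apply: (jacobian_neq0 charF e_inj D1P D2P) => //.
  - by move=> c; rewrite /= bipoly_fracC D1E derivC tofrac0.
  - move=> c; rewrite /= bipoly_fracC D2E (derivation_map_polyC _ dKP) dKE.
    by rewrite derivC [X in X%:P]tofrac0 polyC0 [LHS]tofrac0.
  - by rewrite /= bipoly_fracX D1E derivX tofrac1.
  - by rewrite /= bipoly_fracC D1E derivC tofrac0.
  - by rewrite /= bipoly_fracX D2E (derivation_map_polyX dKP) tofrac0.
  - rewrite /= bipoly_fracC D2E (derivation_map_polyC _ dKP) dKE.
    by rewrite derivX [X in X%:P]tofrac1 polyC1 [LHS]tofrac1.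
  - by rewrite -xE -yE.
have : jacobian D1 D2 (g phi) (g psi) / g r = 0.
  apply: (regular_form_eq0 charK _ D1P D1E D2P D2E).
    by move=> p; apply: size_poly.
  by rewrite -rmorphXn E rmorph_radicand.
move/eqP; rewrite mulf_eq0 (negPf J0) invr_eq0 fmorph_eq0 /= => /eqP r0.
(* There remains [r = 0]: the radicand would then vanish on the whole plane by dominance, but its
   value at [(1, 1)] is 16. *)
have := dominant_vanish dom (p := radicand_at 'X_0 'X_1).
rewrite mpoly_subst_radicand -E r0 expr0n => /(_ erefl 1 1).
rewrite rmorph_radicand /= !mevalXU /pair_fun /=.
have -> : radicand_at 1 1 = 16%:R :> C by rewrite /radicand_at; ring.
by move/eqP; rewrite (negPf (char0 15)).
Qed.

End NoParametrisation.

Theorem corollary2p1 (R : realType) : ~ sqrt_rationalisable R radicand.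
Proof.
move=> [phi [psi [dom [r]]]].
have -> : radicand = radicand_at 'X_0 'X_1 by [].
rewrite rmorph_radicand /= !map_mpolyX mpoly_subst_radicand => /esym.
by apply: no_parametrisation dom => n; rewrite Num.Theory.pnatr_eq0.
Qed.
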